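(* Let $\Lambda$ be a finite-dimensional self-injective $\mathbb{K}$-algebra with an automorphism $\mu$ such that $\Omega^3_{\Lambda^e}(\Lambda)\cong{}_\mu\Lambda_{\mathrm{id}}$ and with Nakayama automorphism $\eta$; put $\gamma=\eta^{-1}\circ\mu$ and assume that every basic maximal rigid module in $\mathrm{mod}\,\Lambda$ is $\gamma$-equivariant. Let $T\oplus X$ be a basic $\gamma$-equivariant rigid module in $\mathrm{mod}\,\Lambda$ such that $X$ is minimal $\gamma$-equivariant, $X=\bigoplus_{i=0}^n{}_{\gamma^i}\tilde X$ with $\tilde X$ indecomposable and $n=|X|-1$, and such that $\Lambda\in\mathrm{add}(T)$. Then for $0\le i\le n$ there exists a short exact sequence $$S_i:\quad 0\to{}_{\gamma^i}\tilde X\xrightarrow{{}_{\gamma^i}\tilde f}{}_{\gamma^i}\tilde T'\xrightarrow{{}_{\gamma^i}\tilde g}{}_{\gamma^i}\tilde Y\to0$$ (the twists by $\gamma^i$ of one sequence $0\to\tilde X\xrightarrow{\tilde f}\tilde T'\xrightarrow{\tilde g}\tilde Y\to0$) such that taking the direct sum $\bigoplus_{i=0}^nS_i$ yields an exact sequence $$0\to X\xrightarrow{f}T'\xrightarrow{g}Y\to0$$ with the following properties: (a) $f=\bigoplus_{i=0}^n{}_{\gamma^i}\tilde f$ is a minimal left $\mathrm{add}(T)$-approximation and $g=\bigoplus_{i=0}^n{}_{\gamma^i}\tilde g$ is a minimal right $\mathrm{add}(T)$-approximation; (b) $Y=\bigoplus_{i=0}^n{}_{\gamma^i}\tilde Y$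 is minimal $\gamma$-equivariant, and $X\ncong Y$; (c) $T\oplus Y$ is basic $\gamma$-equivariant rigid.
   Context: $\mathbb{K}$ is an algebraically closed field; modules are finite-dimensional left modules. For an algebra automorphism $\varphi$ of $\Lambda$ and a module $M$, ${}_\varphi M$ is the twist of $M$ by $\varphi$ ($a$ acts on ${}_\varphi M$ as $\varphi^{-1}(a)$ acts on $M$; same convention for the left action of bimodules ${}_\varphi\Lambda_{\mathrm{id}}$); twisting is a functor, and ${}_\varphi h$ denotes the twist of a morphism $h$. $M$ is $\varphi$-equivariant if ${}_\varphi M\cong M$. A Nakayama automorphism $\eta$ satisfies $\mathrm{Hom}_{\mathbb{K}}(\Lambda,\mathbb{K})\cong{}_{\eta^{-1}}\Lambda_{\mathrm{id}}$ as bimodules. $\Lambda^e$ is the enveloping algebra, $\Omega_{\Lambda^e}$ the syzygy of bimodules. $M$ is rigid if $\mathrm{Ext}^1_\Lambda(M,M)=0$ and maximal rigid if moreover $N\oplus M$ rigid implies $N\in\mathrm{add}(M)$. Basic means pairwise non-isomorphic indecomposable summands; $|X|$ is the number of indecomposable summands of $X$ up to isomorphism. $X$ is minimal $\gamma$-equivariant if it is basic and, with $n=|X|-1$, $X\cong\bigoplus_{i=0}^n{}_{\gamma^i}\tilde X$ with $\tilde X$ indecomposable and ${}_{\gamma^{n+1}}\tilde X\cong\tilde X$. A left $\mathrm{add}(T)$-approximation of $M$ is a map $M\to T'$ with $T'\in\mathrm{add}(T)$ through which every map from $M$ to an object of $\mathrm{add}(T)$ factors; right approximations are dual; minimality is left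 (right) minimality. *)

(* Defs.v *)
From HB Require Import structures.
From mathcomp Require Import all_boot all_order all_algebra all_field.

Set Implicit Arguments.
Unset Strict Implicit.
Unset Printing Implicit Defensive.

Import GRing.Theory.
Local Open Scope ring_scope.

Section Modules.

Variables (K : fieldType) (A : falgType K).

Record lmodule := LModule {
  lm_sort :> vectType K;
  mact : A -> lm_sort -> lm_sort;
  mact_linear : forall a, linear (mact a);
  mact_linear_l : forall x, linear (mact^~ x);
  mact1 : forall x, mact 1 x = x;
  mactM : forall a b x, mact (a * b) x = mact a (mact b x)
}.

Record mhom (M N : lmodule) := MHom {
  mhom_val :> 'Hom(M, N);
  mhomE : forall a x, mhom_val (mact a x) = mact a (mhom_val x)
}.

Definition isom (M N : lmodule) := exists f : mhom M N, bijective f.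

Definition short_exact (L M N : lmodule) (f : mhom L M) (g : mhom M N) :=
  [/\ lker f = 0%VS, limg f = lker g & limg g = fullv].

Lemma regular_linear (a : A) : linear ( *%R a).
Proof. by move=> k x y; rewrite mulrDr scalerAr. Qed.

Lemma regular_linear_l (x : A) : linear ( *%R^~ x).
Proof. by move=> k a b; rewrite mulrDl scalerAl. Qed.

Definition regular : lmodule :=
  @LModule A (fun a x => a * x) regular_linear regular_linear_l (@mul1r A)
    (fun a b x => esym (mulrA a b x)).

Lemma zero_act_linear (a : A) : linear (fun x : 'rV[K]_0 => x).
Proof. by []. Qed.

Lemma zero_act_linear_l (x : 'rV[K]_0) : linear (fun _ : A => x).
Proof. by move=> k a b; apply/matrixP=> i []. Qed.

Definition zero_module : lmodule :=
  @LModule 'rV[K]_0 (fun _ x => x) zero_act_linear zero_act_linear_l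
    (fun _ => erefl) (fun _ _ _ => erefl).

Section DirectSum.

Variables M N : lmodule.

Definition dsum2_act (a : A) (x : (M * N)%type) : (M * N)%type :=
  (mact a x.1, mact a x.2).

Lemma dsum2_act_linear a : linear (dsum2_act a).
Proof. by move=> k x y; rewrite /dsum2_act /= !mact_linear. Qed.

Lemma dsum2_act_linear_l x : linear (dsum2_act^~ x).
Proof. by move=> k a b; rewrite /dsum2_act /= !mact_linear_l. Qed.

Lemma dsum2_act1 x : dsum2_act 1 x = x.
Proof. by rewrite /dsum2_act !mact1; case: x. Qed.

Lemma dsum2_actM a b x : dsum2_act (a * b) x = dsum2_act a (dsum2_act b x).
Proof. by rewrite /dsum2_act !mactM. Qed.

Definition dsum2 : lmodule :=
  LModule dsum2_act_linear dsum2_act_linear_l dsum2_act1 dsum2_actM.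

Definition dsum2_inl_fun (x : M) : dsum2 := (x, 0).
Definition dsum2_snd_fun (x : dsum2) : N := x.2.

Lemma dsum2_inl_linear : linear dsum2_inl_fun.
Proof.
by move=> k x y; rewrite /dsum2_inl_fun; congr pair; rewrite /= scaler0 addr0.
Qed.

Lemma dsum2_snd_linear : linear dsum2_snd_fun.
Proof. by []. Qed.

HB.instance Definition _ :=
  GRing.isLinear.Build K M dsum2 _ dsum2_inl_fun dsum2_inl_linear.
HB.instance Definition _ :=
  GRing.isLinear.Build K dsum2 N _ dsum2_snd_fun dsum2_snd_linear.

Lemma mact_0 (a : A) : mact a (0 : N) = 0.
Proof.
have := mact_linear a 1 (0 : N) 0; rewrite !scale1r addr0.
by rewrite -{1}[mact a 0]addr0 => /addrI <-.
Qed.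

Lemma dsum2_inl_eqv a x :
  linfun dsum2_inl_fun (mact a x) = mact a (linfun dsum2_inl_fun x).
Proof. by rewrite !lfunE; congr pair; rewrite mact_0. Qed.

Lemma dsum2_snd_eqv a x :
  linfun dsum2_snd_fun (mact a x) = mact a (linfun dsum2_snd_fun x).
Proof. by rewrite !lfunE. Qed.

Definition dsum2_inl : mhom M dsum2 := MHom dsum2_inl_eqv.
Definition dsum2_snd : mhom dsum2 N := MHom dsum2_snd_eqv.

Lemma dsum2_exact : short_exact dsum2_inl dsum2_snd.
Proof.
split.
- apply/eqP/lker0P=> x y; rewrite !lfunE /= /dsum2_inl_fun.
  by case.
- apply/vspaceP=> -[x y]; rewrite memv_ker; apply/memv_imgP/eqP.
    by case=> z _ ->; rewrite !lfunE.
  rewrite lfunE /= /dsum2_snd_fun /= => ->.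
  by exists x; rewrite ?memvf // lfunE.
- apply/vspaceP=> y; rewrite memvf; apply/memv_imgP.
  by exists ((0, y) : dsum2); rewrite ?memvf // lfunE.
Qed.

End DirectSum.

Section DirectSumHom.

Variables (M N M' N' : lmodule) (f : mhom M M') (g : mhom N N').

Definition dsum2_hom_fun (x : dsum2 M N) : dsum2 M' N' := (f x.1, g x.2).

Lemma dsum2_hom_linear : linear dsum2_hom_fun.
Proof. by move=> k x y; rewrite /dsum2_hom_fun; congr pair; rewrite /= linearP. Qed.

HB.instance Definition _ := GRing.isLinear.Build K (dsum2 M N) (dsum2 M' N') _
  dsum2_hom_fun dsum2_hom_linear.

Lemma dsum2_hom_eqv a x :
  linfun dsum2_hom_fun (mact a x) = mact a (linfun dsum2_hom_fun x).
Proof. by rewrite !lfunE; congr pair; rewrite /= mhomE. Qed.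

Definition dsum2_hom : mhom (dsum2 M N) (dsum2 M' N') := MHom dsum2_hom_eqv.

End DirectSumHom.

Lemma id_eqv (M : lmodule) a (x : M) : \1%VF (mact a x) = mact a (\1%VF x).
Proof. by rewrite !id_lfunE. Qed.

Definition mhom_id (M : lmodule) : mhom M M := MHom (@id_eqv M).

(* [dsum n F] is the direct sum of F 0, ..., F (n - 1). *)
Fixpoint dsum (n : nat) (F : nat -> lmodule) : lmodule :=
  if n is m.+1 then dsum2 (dsum m F) (F m) else zero_module.

Fixpoint dsum_hom (n : nat) (F G : nat -> lmodule)
    (f : forall i, mhom (F i) (G i)) : mhom (dsum n F) (dsum n G) :=
  match n with
  | 0 => mhom_id zero_module
  | m.+1 => dsum2_hom (dsum_hom m f) (f m)
  end.

Definition is_zero (M : lmodule) := (fullv : {vspace M}) = 0%VS.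

Definition indecomposable (M : lmodule) :=
  ~ is_zero M /\
  (forall N N' : lmodule, isom M (dsum2 N N') -> is_zero N \/ is_zero N').

Definition summand (N M : lmodule) := exists N' : lmodule, isom (dsum2 N N') M.

Definition basic (M : lmodule) :=
  exists (m : nat) (F : nat -> lmodule),
    [/\ forall i, (i < m)%N -> indecomposable (F i),
        forall i j, (i < j < m)%N -> ~ isom (F i) (F j)
      & isom M (dsum m F)].

(* |M| = m, stated as a relation. *)
Definition num_summands (M : lmodule) (m : nat) :=
  exists F : nat -> lmodule,
    [/\ forall i, (i < m)%N -> indecomposable (F i) /\ summand (F i) M,
        forall i j, (i < j < m)%N -> ~ isom (F i) (F j)
      & forall N, indecomposable N -> summand N M ->
          exists2 i, (i < m)%N & isom N (F i)].

Definition in_add (M N : lmodule) :=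
  exists k : nat, summand N (dsum k (fun=> M)).

Record extension (M N : lmodule) := Extension {
  ext_mid : lmodule;
  ext_inj : mhom N ext_mid;
  ext_proj : mhom ext_mid M;
  ext_exact : short_exact ext_inj ext_proj
}.

Definition ext_equiv (M N : lmodule) (E E' : extension M N) :=
  exists h : mhom (ext_mid E) (ext_mid E'),
    h \o ext_inj E =1 ext_inj E' /\ ext_proj E' \o h =1 ext_proj E.

Definition ext_trivial (M N : lmodule) : extension M N :=
  Extension (dsum2_exact N M).

(* Ext^1(M, N) = 0, for the Yoneda description of Ext^1(M, N) as the set of
   equivalence classes of extensions, with zero the class of the trivial one. *)
Definition Ext1_zero (M N : lmodule) :=
  forall E : extension M N, ext_equiv E (ext_trivial M N).

Definition rigid (M : lmodule) := Ext1_zero M M.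

Definition maximal_rigid (M : lmodule) :=
  rigid M /\ (forall N : lmodule, rigid (dsum2 N M) -> in_add M N).

Definition left_approx (T M T' : lmodule) (f : mhom M T') :=
  in_add T T' /\
  (forall (T'' : lmodule) (h : mhom M T''), in_add T T'' ->
     exists u : mhom T' T'', u \o f =1 h).

Definition right_approx (T T' M : lmodule) (g : mhom T' M) :=
  in_add T T' /\
  (forall (T'' : lmodule) (h : mhom T'' M), in_add T T'' ->
     exists u : mhom T'' T', g \o u =1 h).

Definition left_minimal (M N : lmodule) (f : mhom M N) :=
  forall u : mhom N N, u \o f =1 f -> bijective u.

Definition right_minimal (M N : lmodule) (g : mhom M N) :=
  forall u : mhom M M, g \o u =1 g -> bijective u.

Definition minimal_left_approx (T M T' : lmodule) (f : mhom M T') :=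
  left_approx T f /\ left_minimal f.

Definition minimal_right_approx (T T' M : lmodule) (g : mhom T' M) :=
  right_approx T g /\ right_minimal g.

(* Only finite-dimensional test modules occur; since A is finite-dimensional,
   Baer's criterion makes this injectivity among all modules. *)
Definition injective_module (I : lmodule) :=
  forall (M N : lmodule) (j : mhom M N) (f : mhom M I),
    injective j -> exists g : mhom N I, g \o j =1 f.

Definition self_injective := injective_module regular.

Record algaut := AlgAut {
  aut_val :> 'AEnd(A);
  aut_invval : 'AEnd(A);
  autK : cancel aut_val aut_invval;
  autVK : cancel aut_invval aut_val
}.

Definition aut_inv (f : algaut) : algaut := AlgAut (@autVK f) (@autK f).

Definition aut_id : algaut :=
  @AlgAut (id_ahom _) (id_ahom _)
    (fun x => etrans (id_lfunE _) (id_lfunE x))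
    (fun x => etrans (id_lfunE _) (id_lfunE x)).

Section AutComp.

Variables f g : algaut.

Lemma aut_compK :
  cancel (comp_ahom f g) (comp_ahom (aut_invval g) (aut_invval f)).
Proof. by move=> x; rewrite /= !comp_lfunE /= !autK. Qed.

Lemma aut_compVK :
  cancel (comp_ahom (aut_invval g) (aut_invval f)) (comp_ahom f g).
Proof. by move=> x; rewrite /= !comp_lfunE /= !autVK. Qed.

(* x |-> f (g x) *)
Definition aut_comp : algaut := AlgAut aut_compK aut_compVK.

End AutComp.

Definition aut_pow (f : algaut) (i : nat) : algaut := iter i (aut_comp f) aut_id.

Section Twist.

Variables (phi : algaut) (M : lmodule).

Definition twist_act (a : A) (x : M) : M := mact (aut_inv phi a) x.

Lemma twist_act_linear a : linear (twist_act a).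
Proof. by move=> k x y; rewrite /twist_act mact_linear. Qed.

Lemma twist_act_linear_l x : linear (twist_act^~ x).
Proof. by move=> k a b; rewrite /twist_act linearP mact_linear_l. Qed.

Lemma twist_act1 x : twist_act 1 x = x.
Proof. by rewrite /twist_act rmorph1 mact1. Qed.

Lemma twist_actM a b x : twist_act (a * b) x = twist_act a (twist_act b x).
Proof. by rewrite /twist_act rmorphM mactM. Qed.

Definition twist : lmodule :=
  LModule twist_act_linear twist_act_linear_l twist_act1 twist_actM.

End Twist.

Lemma twist_hom_eqv (phi : algaut) (M N : lmodule) (f : mhom M N) a x :
  mhom_val f (twist_act phi a x) = twist_act phi a (mhom_val f x).
Proof. exact: mhomE. Qed.

Definition twist_hom (phi : algaut) (M N : lmodule) (f : mhom M N) :
  mhom (twist phi M) (twist phi N) :=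
  @MHom (twist phi M) (twist phi N) (mhom_val f) (twist_hom_eqv phi f).

Definition equivariant (phi : algaut) (M : lmodule) := isom (twist phi M) M.

(* The direct sum of the twists of M by gamma ^ i for 0 <= i <= n. *)
Definition orbit_sum (gamma : algaut) (n : nat) (M : lmodule) : lmodule :=
  dsum n.+1 (fun i => twist (aut_pow gamma i) M).

Definition orbit_hom (gamma : algaut) (n : nat) (M N : lmodule)
    (f : mhom M N) : mhom (orbit_sum gamma n M) (orbit_sum gamma n N) :=
  dsum_hom n.+1 (fun i => twist_hom (aut_pow gamma i) f).

(* X is minimal gamma-equivariant, with n = |X| - 1 and with X1 as the
   indecomposable module whose twists sum up to X. *)
Definition minimal_equivariant (gamma : algaut) (n : nat) (X1 X : lmodule) :=
  [/\ basic X,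
      num_summands X n.+1,
      indecomposable X1,
      isom X (orbit_sum gamma n X1)
    & isom (twist (aut_pow gamma n.+1) X1) X1].

(* Both actions are K-bilinear, so K acts centrally and these are the
   finite-dimensional modules over the enveloping algebra of A. *)
Record bimodule := Bimodule {
  bm_left :> lmodule;
  ract : A -> bm_left -> bm_left;
  ract_linear : forall a, linear (ract a);
  ract_linear_l : forall x, linear (ract^~ x);
  ract1 : forall x, ract 1 x = x;
  ractM : forall a b x, ract (a * b) x = ract b (ract a x);
  lract : forall a b x, ract b (mact a x) = mact a (ract b x)
}.

Record bhom (M N : bimodule) := BHom {
  bhom_val :> mhom M N;
  bhomE : forall a x, bhom_val (ract a x) = ract a (bhom_val x)
}.

Definition bisom (M N : bimodule) := exists f : bhom M N, bijective f.

Definition bprojective (P : bimodule) :=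
  forall (M N : bimodule) (p : bhom M N) (f : bhom P N),
    limg p = fullv -> exists g : bhom P M, p \o g =1 f.

Definition bprojective_cover (P M : bimodule) (p : bhom P M) :=
  [/\ bprojective P,
      limg p = fullv
    & forall (N : bimodule) (h : bhom N P),
        limg (p \o h)%VF = fullv -> limg h = fullv].

(* Syzygies are kernels of projective covers, determined up to isomorphism:
   the relation says that N is isomorphic to the syzygy of M. *)
Definition is_bsyzygy (M N : bimodule) :=
  exists (P : bimodule) (i : bhom N P) (p : bhom P M),
    bprojective_cover p /\ short_exact i p.

Fixpoint is_iter_bsyzygy (k : nat) (M N : bimodule) : Prop :=
  match k with
  | 0 => bisom N M
  | k'.+1 => exists2 L, is_iter_bsyzygy k' M L & is_bsyzygy L N
  end.

Definition bregular : bimodule :=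
  @Bimodule regular (fun a x => x * a) regular_linear_l regular_linear
    (@mulr1 A) (fun a b x => mulrA x a b) (fun a b x => esym (mulrA a x b)).

Definition btwist (phi : algaut) (M : bimodule) : bimodule :=
  @Bimodule (twist phi M) (@ract M) (@ract_linear M) (@ract_linear_l M)
    (@ract1 M) (@ractM M) (fun a b x => lract (aut_inv phi a) b x).

(* bdual below is Hom_K(A, K) with (a f b)(x) = f (b x a). *)
Definition dual_lact (a : A) (f : 'Hom(A, K^o)) : 'Hom(A, K^o) :=
  (f \o amulr a)%VF.

Definition dual_ract (a : A) (f : 'Hom(A, K^o)) : 'Hom(A, K^o) :=
  (f \o amull a)%VF.

Lemma dual_lact_linear a : linear (dual_lact a).
Proof. by move=> k f g; rewrite /dual_lact comp_lfunDl comp_lfunZl. Qed.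

Lemma dual_lact_linear_l f : linear (dual_lact^~ f).
Proof. by move=> k a b; rewrite /dual_lact linearP comp_lfunDr comp_lfunZr. Qed.

Lemma dual_lact1 f : dual_lact 1 f = f.
Proof. by apply/lfunP=> x; rewrite comp_lfunE lfunE /= mulr1. Qed.

Lemma dual_lactM a b f : dual_lact (a * b) f = dual_lact a (dual_lact b f).
Proof. by apply/lfunP=> x; rewrite !comp_lfunE !lfunE /= mulrA. Qed.

Lemma dual_ract_linear a : linear (dual_ract a).
Proof. by move=> k f g; rewrite /dual_ract comp_lfunDl comp_lfunZl. Qed.

Lemma dual_ract_linear_l f : linear (dual_ract^~ f).
Proof. by move=> k a b; rewrite /dual_ract linearP comp_lfunDr comp_lfunZr. Qed.

Lemma dual_ract1 f : dual_ract 1 f = f.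
Proof. by apply/lfunP=> x; rewrite comp_lfunE lfunE /= mul1r. Qed.

Lemma dual_ractM a b f : dual_ract (a * b) f = dual_ract b (dual_ract a f).
Proof. by apply/lfunP=> x; rewrite !comp_lfunE !lfunE /= mulrA. Qed.

Lemma dual_lract a b f :
  dual_ract b (dual_lact a f) = dual_lact a (dual_ract b f).
Proof. by apply/lfunP=> x; rewrite !comp_lfunE !lfunE /= mulrA. Qed.

Definition dual_lmodule : lmodule :=
  @LModule _ dual_lact dual_lact_linear dual_lact_linear_l dual_lact1 dual_lactM.

Definition bdual : bimodule :=
  @Bimodule dual_lmodule dual_ract dual_ract_linear dual_ract_linear_l
    dual_ract1 dual_ractM dual_lract.

Definition nakayama_automorphism (eta : algaut) :=
  bisom bdual (btwist (aut_inv eta) bregular).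

End Modules.

Arguments regular {K} A.
Arguments self_injective {K} A.
Arguments bregular {K} A.

(* Main.v *)
(* Put [gamma = eta^-1 o mu].  The isomorphism between the third syzygy of the
   bimodule A and its twist by mu, together with the Nakayama automorphism, yields
   the twisted 2-Calabi-Yau property: Ext^1(M, N) = 0 implies
   Ext^1(gamma^-1 N, M) = 0.  Instead of tensoring the bimodule resolution with M,
   one applies Hom_A(-, N) to it; a projective bimodule P gives an injective module
   Hom_A(P, N), since extending a map into it amounts to lifting a bimodule map out
   of P.  This produces an exact sequence 0 -> N -> J0 -> J1 -> J2 -> mu^-1 N -> 0
   with J_i injective, hence a summand of a free module.  A Frobenius form on A
   gives a trace pairing between Hom(J, M) and Hom(M, nu J), which turns the
   exactness expressing Ext^1(M, N) = 0 into the one expressing the conclusion.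

   For the exchange sequence, take a minimal left add(T)-approximation of X1 with
   cokernel Y1; it is injective because A is in add(T).  Then Ext^1(Y, T) = 0 by
   construction, Ext^1(T, Y) = 0 by the 2-Calabi-Yau property and equivariance of
   T, and Ext^1(Y, Y) = 0 since every map X -> Y extends to T'.  Minimality of the
   two maps means that neither X nor Y has a nonzero summand in add(T); in this
   form it passes to direct sums by Krull-Schmidt. *)
From HB Require Import structures.
Require Import Defs.
From mathcomp Require Import all_boot all_algebra all_field.
From Stdlib Require Import Classical.

Set Implicit Arguments.
Unset Strict Implicit.
Unset Printing Implicit Defensive.

Import GRing.Theory.
Local Open Scope ring_scope.

(** * Module homomorphisms *)

Section Homomorphisms.

Variables (K : fieldType) (A : falgType K).
Implicit Types L M N P : lmodule A.

(** No long exact sequence is built: vanishing of $\mathrm{Ext}^1$ is used as a lifting or extension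
    property, and dimension shifting is one diagram chase. The functor $\mathrm{Hom}_A(-,N)$ stays
    exact on the bimodule resolution because each step splits over A on the left: A is left
    projective, so are projective bimodules, hence so are the successive syzygies. The coefficients
    are in fact taken to be the twist of N by [eta]. On summands of free modules the Nakayama
    functor is the twist by $\eta^{-1}$, so it returns N at the left end, where the hypothesis on
    $\mathrm{Ext}^1(M,N)$ applies, while the right end becomes $\mu^{-1}\eta N=\gamma^{-1}N$. The
    remaining obstacle is that Y1 must be indecomposable, of the right period, and with pairwise
    non-isomorphic twists. All of this is transported from X1: maps at one end of a sequence induce
    maps at the other, well defined up to maps through add(T), and such maps are never invertible on
    an indecomposable outside add(T). *)

HB.instance Definition _ M a :=
  GRing.isLinear.Build K M M _ (@mact K A M a) (@mact_linear K A M a).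

Lemma mactDl M (a b : A) (x : M) : mact (a + b) x = mact a x + mact b x.
Proof. by have := mact_linear_l x 1 a b; rewrite !scale1r. Qed.

Lemma mact0l M (x : M) : mact (0 : A) x = 0.
Proof. by apply: (addrI (mact 0 x)); rewrite -mactDl !addr0. Qed.

Lemma mactZl M (k : K) (a : A) (x : M) : mact (k *: a) x = k *: mact a x.
Proof. by have := mact_linear_l x k a 0; rewrite !addr0 mact0l addr0. Qed.

Lemma linear_fun_exists (V W : vectType K) (f : V -> W) :
  linear f -> exists h : 'Hom(V, W), h =1 f.
Proof.
move=> lf; pose F := HB.pack_for {linear V -> W} f
  (GRing.isLinear.Build K V W _ f lf).
by exists (linfun F) => x; rewrite lfunE.
Qed.

(** Most morphisms below come from existence statements with a pointwise description, so that later
    arguments compare values instead of unfolding constructions. *)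
Lemma mhom_exists M N (f : M -> N) : linear f ->
  (forall a x, f (mact a x) = mact a (f x)) -> exists h : mhom M N, h =1 f.
Proof.
move=> /linear_fun_exists[h hE] eqv.
have heqv a x : h (mact a x) = mact a (h x) by rewrite !hE eqv.
by exists (MHom heqv).
Qed.

Lemma mcomp_eqv L M N (g : mhom M N) (f : mhom L M) a x :
  (g \o f)%VF (mact a x) = mact a ((g \o f)%VF x).
Proof. by rewrite !comp_lfunE !mhomE. Qed.
Definition mcomp L M N (g : mhom M N) (f : mhom L M) : mhom L N :=
  MHom (mcomp_eqv g f).
Lemma mcompE L M N (g : mhom M N) (f : mhom L M) x : mcomp g f x = g (f x).
Proof. exact: comp_lfunE. Qed.

Lemma madd_eqv M N (f g : mhom M N) a x :
  (mhom_val f + mhom_val g) (mact a x) = mact a ((mhom_val f + mhom_val g) x).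
Proof. by rewrite !add_lfunE !mhomE linearD. Qed.
Definition madd M N (f g : mhom M N) : mhom M N := MHom (madd_eqv f g).
Lemma maddE M N (f g : mhom M N) x : madd f g x = f x + g x.
Proof. exact: add_lfunE. Qed.

Lemma msub_eqv M N (f g : mhom M N) a x :
  (mhom_val f - mhom_val g) (mact a x) = mact a ((mhom_val f - mhom_val g) x).
Proof. by rewrite !add_lfunE !opp_lfunE !mhomE linearB. Qed.
Definition msub M N (f g : mhom M N) : mhom M N := MHom (msub_eqv f g).
Lemma msubE M N (f g : mhom M N) x : msub f g x = f x - g x.
Proof. by rewrite /= add_lfunE opp_lfunE. Qed.

Lemma mscale_eqv M N k (f : mhom M N) a x :
  (k *: mhom_val f) (mact a x) = mact a ((k *: mhom_val f) x).
Proof. by rewrite !scale_lfunE !mhomE linearZ. Qed.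
Definition mscale M N k (f : mhom M N) : mhom M N := MHom (mscale_eqv k f).
Lemma mscaleE M N k (f : mhom M N) x : mscale k f x = k *: f x.
Proof. exact: scale_lfunE. Qed.

Lemma mzero_eqv M N a x :
  (0 : 'Hom(M, N)) (mact a x) = mact a ((0 : 'Hom(M, N)) x).
Proof. by rewrite !zero_lfunE linear0. Qed.
Definition mzero M N : mhom M N := MHom (@mzero_eqv M N).
Lemma mzeroE M N x : mzero M N x = 0.
Proof. exact: zero_lfunE. Qed.

Lemma midE M x : mhom_id M x = x.
Proof. exact: id_lfunE. Qed.


Definition mhE := (mcompE, maddE, msubE, mscaleE, mzeroE, midE).

Lemma mhom_bijP M N (f : mhom M N) :
  bijective f <-> injective f /\ forall y, exists x, f x = y.
Proof.
split=> [[g fK gK]|[fI fS]].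
  by split=> [|y]; [exact: can_inj fK | exists (g y)].
exists (f^-1)%VF => [x|y].
  by rewrite lker0_lfunK //; apply/lker0P.
by rewrite limg_lfunVK //; have [x <-] := fS y; rewrite memv_img ?memvf.
Qed.

Lemma mhom_endo_bij M (u : mhom M M) : injective u -> bijective u.
Proof.
move=> uI; have k0 : lker u == 0%VS by apply/lker0P.
by exists (u^-1)%VF; [exact: lker0_lfunK | exact: lker0_lfunVK].
Qed.

Lemma mhom_injP M N (f : mhom M N) : (forall x, f x = 0 -> x = 0) -> injective f.
Proof. exact: raddf_inj. Qed.

Lemma mhom_bij_inv M N (f : mhom M N) : bijective f ->
  exists g : mhom N M, cancel f g /\ cancel g f.
Proof.
case=> g fK gK.
have lg : linear g by move=> k x y; apply: (can_inj fK); rewrite linearP /= !gK.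
have eg a x : g (mact a x) = mact a (g x).
  by apply: (can_inj fK); rewrite mhomE !gK.
by have [h hE] := mhom_exists lg eg; exists h; split=> x; rewrite hE.
Qed.

Lemma isom_intro M N (f : mhom M N) (g : mhom N M) :
  (forall x, g (f x) = x) -> (forall y, f (g y) = y) -> isom M N.
Proof. by move=> fK gK; exists f, g. Qed.

Lemma isom_inv M N : isom M N ->
  exists (f : mhom M N) (g : mhom N M), cancel f g /\ cancel g f.
Proof. by case=> f /mhom_bij_inv[g fgK]; exists f, g. Qed.

Lemma isom_refl M : isom M M.
Proof. by exists (mhom_id M); exists id => x; rewrite midE. Qed.

Lemma isom_sym M N : isom M N -> isom N M.
Proof. by case/isom_inv=> f [g [fK gK]]; exists g, f. Qed.

Lemma isom_trans L M N : isom L M -> isom M N -> isom L N.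
Proof.
case/isom_inv=> f [f' [fK f'K]] /isom_inv[g [g' [gK g'K]]].
by apply: (@isom_intro _ _ (mcomp g f) (mcomp f' g')) => x; rewrite !mhE ?(gK, f'K).
Qed.

Lemma short_exactP L M N (f : mhom L M) (g : mhom M N) :
  short_exact f g <-> [/\ injective f,
    forall y, g y = 0 <-> exists x, f x = y & forall z, exists y, g y = z].
Proof.
split=> [[kf imk img]|[fI ex gS]].
  split; first by apply/lker0P; rewrite kf.
    move=> y; split=> [gy0|[x <-]].
      have : y \in limg f by rewrite imk memv_ker gy0.
      by case/memv_imgP=> x _ ->; exists x.
    by apply/eqP; rewrite -memv_ker -imk memv_img ?memvf.
  move=> z; have : z \in limg g by rewrite img memvf.
  by case/memv_imgP=> y _ ->; exists y.
split.
- by apply/eqP/lker0P.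
- apply/vspaceP=> y; rewrite memv_ker; apply/memv_imgP/eqP.
    by case=> x _ ->; apply/ex; exists x.
  by move/ex=> [x <-]; exists x; rewrite ?memvf.
- apply/vspaceP=> z; rewrite memvf; apply/memv_imgP.
  by have [y <-] := gS z; exists y; rewrite ?memvf.
Qed.

Lemma short_exact0 L M N (f : mhom L M) (g : mhom M N) x :
  short_exact f g -> g (f x) = 0.
Proof. by case/short_exactP=> _ ex _; apply/ex; exists x. Qed.

(** The linear right inverse [g^-1] may fail to commute with the action, but only by elements of the
    kernel of [g], which [h] kills; so [h \o g^-1] is A-linear. *)
Lemma factor_through_surj M N P (g : mhom M N) (h : mhom M P) :
  (forall z, exists y, g y = z) -> (forall x, g x = 0 -> h x = 0) ->
  exists k : mhom N P, forall x, k (g x) = h x.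
Proof.
move=> gS gh.
have hE x : h ((g^-1)%VF (g x)) = h x.
  apply/eqP; rewrite -subr_eq0 -linearB /=; apply/eqP/gh.
  by rewrite linearB /= limg_lfunVK ?subrr // memv_img ?memvf.
have eqv a z : (h \o g^-1)%VF (mact a z) = mact a ((h \o g^-1)%VF z).
  have [y <-] := gS z.
  by rewrite -mhomE !comp_lfunE !hE mhomE.
by exists (MHom eqv) => x; rewrite /= comp_lfunE hE.
Qed.

Lemma factor_through_inj L M P (f : mhom L M) (h : mhom P M) :
  injective f -> (forall x, exists y, f y = h x) ->
  exists k : mhom P L, forall x, f (k x) = h x.
Proof.
move=> fI fh.
have hE x : f ((f^-1)%VF (h x)) = h x.
  by have [y <-] := fh x; rewrite limg_lfunVK // memv_img ?memvf.
have eqv a x : (f^-1 \o h)%VF (mact a x) = mact a ((f^-1 \o h)%VF x).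
  by apply: fI; rewrite !comp_lfunE hE !mhomE hE.
by exists (MHom eqv) => x; rewrite /= comp_lfunE hE.
Qed.

Lemma submodule_exists M (U : {vspace M}) :
  (forall a x, x \in U -> mact a x \in U) ->
  exists (S : lmodule A) (i : mhom S M), injective i /\
    forall x, x \in U <-> exists y, i y = x.
Proof.
move=> stab; pose act a (s : subvs_of U) := vsproj U (mact a (vsval s)).
have actE a s : vsval (act a s) = mact a (vsval s).
  by rewrite vsprojK // stab ?subvsP.
have inj := @subvs_inj _ _ U.
have l1 a : linear (act a).
  by move=> k x y; apply: inj; rewrite linearP /= !actE !linearP.
have l2 x : linear (act^~ x).
  by move=> k a b; apply: inj; rewrite linearP /= !actE mact_linear_l.
have l3 x : act 1 x = x by apply: inj; rewrite actE mact1.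
have l4 a b x : act (a * b) x = act a (act b x).
  by apply: inj; rewrite !actE mactM.
pose S := LModule l1 l2 l3 l4.
have [i iE] := @mhom_exists S M (@vsval _ _ U) (@linearP _ _ _ _ _) actE.
exists S, i; split=> [x y|x]; first by rewrite !iE => /inj.
split=> [xU|[y <-]]; last by rewrite iE subvsP.
by exists (vsproj U x); rewrite iE vsprojK.
Qed.

(** The carrier is a linear complement of U, which is rarely stable: the algebra acts inside M and
    the result is projected back along U. Stability of U makes this an action. *)
Lemma quotient_exists M (U : {vspace M}) :
  (forall a x, x \in U -> mact a x \in U) ->
  exists (Q : lmodule A) (p : mhom M Q), (forall y, exists x, p x = y) /\
    forall x, x \in U <-> p x = 0.
Proof.
move=> stab; set V := (U^C)%VS.
have VU : (V :&: U = 0)%VS by rewrite capvC capv_compl.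
have UV : (U :&: V = 0)%VS by rewrite capv_compl.
have full x : x \in (V + U)%VS by rewrite addvC addv_complf memvf.
have p0U x : x \in U <-> daddv_pi V U x = 0.
  have e := daddv_pi_add VU (full x).
  split=> [xU|p0]; last by rewrite -e p0 add0r memv_pi.
  by rewrite (daddv_pi_id UV xU) in e; apply: (addIr x); rewrite e add0r.
pose p := (linfun (vsproj V) \o daddv_pi V U)%VF.
have pU x : x \in U <-> p x = 0.
  rewrite p0U /p comp_lfunE lfunE /=; split=> [->|]; first by rewrite linear0.
  by move/(congr1 vsval); rewrite vsprojK ?memv_pi // linear0.
have pK v : p (vsval v) = v.
  apply: subvs_inj; rewrite /p comp_lfunE lfunE /= vsprojK ?memv_pi //.
  by rewrite daddv_pi_id ?subvsP.
pose act a (v : subvs_of V) := p (mact a (vsval v)).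
have actE a x : act a (p x) = p (mact a x).
  apply/eqP; rewrite -subr_eq0 -linearB -linearB /=; apply/eqP.
  by rewrite -pU; apply: stab; rewrite pU linearB /= pK subrr.
have l1 a : linear (act a) by move=> k x y; rewrite /act !linearP.
have l2 v : linear (act^~ v).
  by move=> k a b; rewrite /act mact_linear_l linearP.
have l3 v : act 1 v = v by rewrite /act mact1 pK.
have l4 a b v : act (a * b) v = act a (act b v).
  by rewrite -(pK v) !actE mactM.
pose Q := LModule l1 l2 l3 l4.
have eqv a x : p (mact a x) = mact a (p x : Q) by rewrite -actE.
exists Q, (@MHom _ _ M Q p eqv); split=> // y.
by exists (vsval y); apply: pK.
Qed.

Lemma kernel_exists M N (g : mhom M N) :
  exists (S : lmodule A) (i : mhom S M), injective i /\
    forall y, g y = 0 <-> exists x, i x = y.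
Proof.
have [|S [i [iI iE]]] := @submodule_exists M (lker g).
  by move=> a x; rewrite !memv_ker mhomE => /eqP ->; rewrite linear0.
by exists S, i; split=> // y; rewrite -iE memv_ker; split=> /eqP.
Qed.

Lemma image_stable M N (f : mhom M N) a y : y \in limg f -> mact a y \in limg f.
Proof. by case/memv_imgP=> x _ ->; rewrite -mhomE memv_img ?memvf. Qed.

Lemma mem_limgP M N (f : mhom M N) y : y \in limg f <-> exists x, f x = y.
Proof.
split=> [/memv_imgP[x _ ->]|[x <-]]; first by exists x.
by rewrite memv_img ?memvf.
Qed.

Lemma cokernel_exists L M (f : mhom L M) :
  exists (Q : lmodule A) (g : mhom M Q), (forall z, exists y, g y = z) /\
    forall y, g y = 0 <-> exists x, f x = y.
Proof.
have [Q [g [gS gE]]] := quotient_exists (@image_stable _ _ f).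
by exists Q, g; split=> // y; rewrite -gE mem_limgP.
Qed.

Lemma is_zeroP M : is_zero M <-> forall x : M, x = 0.
Proof.
rewrite /is_zero; split=> [z x|z]; first by apply/eqP; rewrite -memv0 -z memvf.
by apply/vspaceP=> x; rewrite (z x) !mem0v.
Qed.

Lemma dsum2_pr1_exists M N : exists p : mhom (dsum2 M N) M, forall x, p x = x.1.
Proof. by apply: mhom_exists. Qed.

Lemma dsum2_in2_exists M N : exists i : mhom N (dsum2 M N), forall x, i x = (0, x).
Proof.
apply: mhom_exists => [k x y|a x]; congr pair; rewrite /= ?linear0 //.
by rewrite addr0.
Qed.

Lemma dsum2_inlE M N x : dsum2_inl M N x = (x, 0).
Proof. exact: lfunE. Qed.
Lemma dsum2_sndE M N x : dsum2_snd M N x = x.2.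
Proof. exact: lfunE. Qed.
Lemma dsum2_homE M N M' N' (f : mhom M M') (g : mhom N N') x :
  dsum2_hom f g x = (f x.1, g x.2).
Proof. exact: lfunE. Qed.

Lemma copair_exists M N P (f : mhom M P) (g : mhom N P) :
  exists h : mhom (dsum2 M N) P, forall x, h x = f x.1 + g x.2.
Proof.
apply: mhom_exists => [k x y|a x]; last by rewrite !mhomE linearD.
by rewrite /= !linearP /= scalerDr addrACA.
Qed.

Lemma pair_exists M N P (f : mhom P M) (g : mhom P N) :
  exists h : mhom P (dsum2 M N), forall x, h x = (f x, g x).
Proof.
apply: mhom_exists => [k x y|a x]; last by rewrite !mhomE.
by rewrite !linearP.
Qed.

End Homomorphisms.

#[global] Opaque mcomp madd msub mscale mzero mhom_id dsum2_inl dsum2_snd dsum2_hom.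

(** * Krull-Schmidt theory *)

Section KrullSchmidt.

Variables (K : fieldType) (A : falgType K).
Implicit Types L M N P S : lmodule A.

Lemma dsum2C M N : isom (dsum2 M N) (dsum2 N M).
Proof.
have [f fE] : exists f : mhom (dsum2 M N) (dsum2 N M), f =1 (fun x => (x.2, x.1)).
  by apply: mhom_exists.
have [g gE] : exists g : mhom (dsum2 N M) (dsum2 M N), g =1 (fun x => (x.2, x.1)).
  by apply: mhom_exists.
by apply: (@isom_intro _ _ _ _ f g) => -[x y]; rewrite fE gE.
Qed.

Lemma dsum2A M N P : isom (dsum2 M (dsum2 N P)) (dsum2 (dsum2 M N) P).
Proof.
have [f fE] : exists f : mhom (dsum2 M (dsum2 N P)) (dsum2 (dsum2 M N) P),
    f =1 (fun x => ((x.1, x.2.1), x.2.2)) by apply: mhom_exists.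
have [g gE] : exists g : mhom (dsum2 (dsum2 M N) P) (dsum2 M (dsum2 N P)),
    g =1 (fun x => (x.1.1, (x.1.2, x.2))) by apply: mhom_exists.
by apply: (@isom_intro _ _ _ _ f g) => -[] => [x [y z]|[x y] z]; rewrite fE gE.
Qed.

Lemma isom_dsum2 M N M' N' :
  isom M M' -> isom N N' -> isom (dsum2 M N) (dsum2 M' N').
Proof.
case/isom_inv=> f [f' [fK f'K]] /isom_inv[g [g' [gK g'K]]].
apply: (@isom_intro _ _ _ _ (dsum2_hom f g) (dsum2_hom f' g')) => -[x y].
  by rewrite !dsum2_homE /= fK gK.
by rewrite !dsum2_homE /= f'K g'K.
Qed.

Lemma isom_dsum2_zero M N : is_zero N -> isom (dsum2 M N) M.
Proof.
move/is_zeroP=> N0; have [p pE] := dsum2_pr1_exists M N.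
apply: (isom_intro (f := p) (g := dsum2_inl M N)) => [[x y]|x].
  by rewrite dsum2_inlE pE (N0 y).
by rewrite dsum2_inlE pE.
Qed.

(** The relations p i' = 0 and p' i = 0 follow: applying p to the third equation at i' x gives p (i'
    x) twice on the left and once on the right, and symmetrically for p'. *)
Lemma biproduct_isom M N N' (i : mhom N M) (p : mhom M N)
    (i' : mhom N' M) (p' : mhom M N') :
  (forall x, p (i x) = x) -> (forall x, p' (i' x) = x) ->
  (forall x, i (p x) + i' (p' x) = x) -> isom M (dsum2 N N').
Proof.
move=> pi pi' ip.
have pi'0 x : p (i' x) = 0.
  have := congr1 p (ip (i' x)).
  by rewrite linearD /= pi pi' -{3}[p (i' x)]add0r => /addIr.
have p'i0 x : p' (i x) = 0.
  have := congr1 p' (ip (i x)).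
  by rewrite linearD /= pi pi' -{3}[p' (i x)]addr0 => /addrI.
have [f fE] := pair_exists p p'; have [g gE] := copair_exists i i'.
apply: (isom_intro (f := f) (g := g)) => [x|[x y]]; first by rewrite gE fE ip.
by rewrite fE gE /= !linearD /= pi pi' pi'0 p'i0 addr0 add0r.
Qed.

(** The complement is the kernel of [p], with projection 1 - i p. Split injections compose, so this
    form replaces explicit complements. *)
Lemma summandP N M : summand N M <->
  exists (i : mhom N M) (p : mhom M N), forall x, p (i x) = x.
Proof.
split=> [[N' /isom_inv[f [g [fK gK]]]]|[i [p pi]]].
  have [q qE] := dsum2_pr1_exists N N'.
  by exists (mcomp f (dsum2_inl N N')), (mcomp q g) => x; rewrite !mhE fK dsum2_inlE qE.
have [N' [j [jI jE]]] := kernel_exists p.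
have [q qE] : exists q : mhom M N', forall x, j (q x) = msub (mhom_id M) (mcomp i p) x.
  by apply: factor_through_inj => // x; apply/jE; rewrite !mhE linearB /= pi subrr.
exists N'; apply/isom_sym.
apply: (biproduct_isom (i := i) (p := p) (i' := j) (p' := q)) => // x.
  apply: jI; rewrite qE !mhE; have -> : p (j x) = 0 by apply/jE; exists x.
  by rewrite linear0 subr0.
by rewrite qE !mhE addrC subrK.
Qed.

Lemma summand_intro N M (i : mhom N M) (p : mhom M N) :
  (forall x, p (i x) = x) -> summand N M.
Proof. by move=> pi; apply/summandP; exists i, p. Qed.

Lemma isom_summand M N : isom M N -> summand M N.
Proof. by case/isom_inv=> f [g [fK _]]; apply: summand_intro fK. Qed.

Lemma summand_refl M : summand M M.
Proof. exact/isom_summand/isom_refl. Qed.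

Lemma summand_trans L M N : summand L M -> summand M N -> summand L N.
Proof.
case/summandP=> i [p pi] /summandP[j [q qj]].
by apply: (@summand_intro _ _ (mcomp j i) (mcomp p q)) => x; rewrite !mhE qj pi.
Qed.

Lemma summand_dsum2 M N M' N' :
  summand M M' -> summand N N' -> summand (dsum2 M N) (dsum2 M' N').
Proof.
case/summandP=> f [f' fK] /summandP[g [g' gK]].
apply: (@summand_intro _ _ (dsum2_hom f g) (dsum2_hom f' g')) => -[x y].
by rewrite !dsum2_homE /= fK gK.
Qed.

Lemma summand_dsum2l M N : summand M (dsum2 M N).
Proof. by exists N; apply: isom_refl. Qed.

Lemma summand_dsum2r M N : summand N (dsum2 M N).
Proof. by exists M; apply: dsum2C. Qed.

Lemma idempotent_split M (e : mhom M M) : (forall x, e (e x) = e x) ->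
  exists S (i : mhom S M) (p : mhom M S),
    (forall x, p (i x) = x) /\ (forall x, i (p x) = e x).
Proof.
move=> ee; have [S [i [iI iE]]] := submodule_exists (@image_stable _ _ _ _ e).
have [p pE] : exists p : mhom M S, forall x, i (p x) = e x.
  by apply: factor_through_inj => // x; apply/iE/mem_limgP; exists x.
exists S, i, p; split=> // x; apply: iI; rewrite pE.
have /iE/mem_limgP[y <-] : exists y, i y = i x by exists x.
exact: ee.
Qed.

Lemma iter_mhom M (u : mhom M M) k : exists w : mhom M M, w =1 iter k u.
Proof.
elim: k => [|k [w wE]]; first by exists (mhom_id M) => x; rewrite midE.
by exists (mcomp u w) => x; rewrite mcompE wE.
Qed.

(** Each strict increase reduces b - a k, so doubling must stall. Fitting's lemma only compares the
    kernels of u^k and u^(2k), hence the doubling. *)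
Lemma bounded_doubling (a : nat -> nat) b :
  (forall k, a k <= b)%N -> (forall k, a k <= a (k + k))%N ->
  exists2 k, (0 < k)%N & a (k + k)%N = a k.
Proof.
move=> ab am; suff H m k : (b - a k < m)%N -> (0 < k)%N ->
    exists2 k, (0 < k)%N & a (k + k)%N = a k by exact: (H _ 1%N (leqnn _)).
elim: m k => [//|m IH] k bk k0; have := am k; rewrite leq_eqVlt.
case/orP=> [/eqP ak|lt]; first by exists k; rewrite // -ak.
apply: (IH (k + k)%N); last by rewrite addn_gt0 k0.
rewrite -ltnS (leq_trans _ bk) // ltnS ltn_sub2l //.
exact: leq_trans (ab (k + k)%N).
Qed.

(* Fitting: [e] is the projection onto the kernel of a high power of [u],
   along the image of that power. *)
Lemma fitting M (u : mhom M M) : exists (e : mhom M M) k, [/\ (0 < k)%N,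
  forall x, e (e x) = e x, forall x, iter k u (e x) = 0,
  forall x, e (iter k u x) = 0 & forall x, iter k u x = 0 -> e x = x].
Proof.

pose W k : 'Hom(M, M) := iter k (fun g => (u \o g)%VF) \1%VF.
have WE k x : W k x = iter k u x.
  by elim: k => [|k IH] /=; rewrite ?id_lfunE // comp_lfunE IH.
have Wact k a x : W k (mact a x) = mact a (W k x).
  by rewrite !WE; elim: k => //= k ->; rewrite mhomE.
have WD k x : W (k + k)%N x = W k (W k x) by rewrite !WE iterD.
have [||k k0 dimk] := @bounded_doubling (fun k => \dim (lker (W k))) (\dim (fullv : {vspace M})).
- by move=> k; rewrite dimvS // subvf.
- move=> k; rewrite dimvS //; apply/subvP=> x; rewrite !memv_ker WD => /eqP ->.
  by rewrite linear0.
set U := lker (W k); set V := limg (W k).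
have eqU : lker (W (k + k)%N) = U.
  apply/esym/eqP; rewrite eqEdim dimk leqnn andbT.
  by apply/subvP=> x; rewrite !memv_ker WD => /eqP ->; rewrite linear0.
have UV : (U :&: V = 0)%VS.
  apply/eqP; rewrite -subv0; apply/subvP=> y; rewrite memv_cap memv0 => /andP[].
  move=> yU /memv_imgP[x _ yx]; rewrite yx -memv_ker -/U -eqU memv_ker WD -yx.
  by rewrite -memv_ker.
have VU : (V :&: U = 0)%VS by rewrite capvC.
have full : (U + V = fullv)%VS.
  apply/eqP; rewrite eqEdim subvf /= dimv_disjoint_sum //.
  by rewrite -(limg_ker_dim (W k) fullv) capfv.
pose e := daddv_pi U V.
have eD x : e x + daddv_pi V U x = x by rewrite daddv_pi_add // full memvf.
have eU x : x \in U -> e x = x by move=> xU; rewrite /e daddv_pi_id.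
have eV x : x \in V -> e x = 0.
  move=> xV; have := eD x; rewrite (daddv_pi_id VU xV) => h.
  by apply: (addIr x); rewrite h add0r.
have eact a x : e (mact a x) = mact a (e x).
  have aU : e (mact a (e x)) = mact a (e x).
    apply: eU; have := memv_pi U V x; rewrite -/e /U !memv_ker Wact => /eqP ->.
    by rewrite linear0.
  have aV : e (mact a (daddv_pi V U x)) = 0.
    apply: eV; have /memv_imgP[z _ ->] := memv_pi V U x.
    by rewrite -Wact memv_img ?memvf.
  by rewrite -{1}[x]eD linearD linearD /= aU aV addr0.
exists (MHom eact), k; split=> //= x.
- by rewrite -/e eU // memv_pi.
- by rewrite -WE; apply/eqP; rewrite -memv_ker memv_pi.
- by rewrite -WE eV // memv_img ?memvf.
- by rewrite -WE => /eqP; rewrite -memv_ker; apply: eU.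
Qed.

Definition mdim M := \dim (fullv : {vspace M}).

Lemma mdim_inj M N (f : mhom M N) : injective f -> (mdim M <= mdim N)%N.
Proof.
move/lker0P/eqP=> k0; rewrite /mdim -(limg_ker_dim f) k0 capv0 dimv0.
by rewrite dimvS ?subvf.
Qed.

Lemma mdim_inj_bij M N (f : mhom M N) :
  injective f -> mdim M = mdim N -> bijective f.
Proof.
move=> fI d; apply/mhom_bijP; split=> // y; apply/mem_limgP.
suff -> : limg f = fullv by rewrite memvf.
apply/eqP; rewrite eqEdim subvf /= -/(mdim N) -d.
have /lker0P/eqP k0 := fI.
by rewrite /mdim -(limg_ker_dim f) k0 capv0 dimv0.
Qed.

Lemma indecomposable_idempotent M (e : mhom M M) : indecomposable M ->
  (forall x, e (e x) = e x) -> (forall x, e x = 0) \/ (forall x, e x = x).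
Proof.
case=> _ ind ee; have [S [i [p [pi ip]]]] := idempotent_split ee.
pose e' := msub (mhom_id M) e.
have e'e' x : e' (e' x) = e' x.
  by rewrite /e' !mhE linearB /= ee subrr subr0.
have [S' [i' [p' [pi' ip']]]] := idempotent_split e'e'.
have /ind[/is_zeroP z|/is_zeroP z] : isom M (dsum2 S S').
  apply: (biproduct_isom pi pi') => x.
  by rewrite ip ip' /e' !mhE addrC subrK.
  by left=> x; rewrite -ip (z (p x)) linear0.
right=> x; apply/esym/eqP; rewrite -subr_eq0; apply/eqP.
have := ip' x; rewrite (z (p' x)) linear0 /e' !mhE.
by move=> ->.
Qed.

(** The Fitting idempotent is 0 or 1. If it is 0, u is injective, hence bijective by dimension; if
    it is 1, a power of u vanishes. *)
Lemma indecomposable_endo M (u : mhom M M) : indecomposable M ->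
  bijective u \/ exists k, forall x, iter k u x = 0.
Proof.
move=> ind; have [e [k [k0 ee we ew kere]]] := fitting u.
case: (indecomposable_idempotent ind ee) => e01; last first.
  by right; exists k => x; rewrite -(e01 x) we.
left; apply/mhom_endo_bij/mhom_injP => x ux; rewrite -(e01 x); apply/esym/kere.
by case: k k0 {we ew kere} => // k _; rewrite iterSr ux; elim: k => //= k ->; rewrite linear0.
Qed.

Lemma unipotent_bij M (u v : mhom M M) k :
  (forall x, u x + v x = x) -> (forall x, iter k u x = 0) -> bijective v.
Proof.
move=> uv uk; apply/mhom_endo_bij/mhom_injP => x vx.
have ux : u x = x by rewrite -[RHS]uv vx addr0.
by rewrite -(uk x); elim: k {uk} => //= k <-.
Qed.

Lemma indecomposable_local M (u v : mhom M M) : indecomposable M ->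
  (forall x, u x + v x = x) -> bijective u \/ bijective v.
Proof.
move=> ind uv; case: (indecomposable_endo u ind) => [|[k uk]]; first by left.
by right; apply: unipotent_bij uk.
Qed.

(** With w the inverse of u, the non-invertible w v is nilpotent. A kernel vector of 1 + w v equals,
    up to sign, its image under every power of w v, so it is 0. *)
Lemma bij_add_nonbij M (u v : mhom M M) : indecomposable M ->
  bijective u -> ~ bijective v -> bijective (madd u v).
Proof.
move=> ind /mhom_bij_inv[w [uK wK]] vN.
have wvN : ~ bijective (mcomp w v).
  move=> b; apply: vN; apply: (@eq_bij _ _ (u \o mcomp w v)).
    by apply: bij_comp => //; exists w.
  by move=> x; rewrite /= mhE wK.
case: (indecomposable_endo (mcomp w v) ind) => // -[k nk].
have b : bijective (madd (mhom_id M) (mcomp w v)).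
  apply/mhom_endo_bij/mhom_injP => x; rewrite !mhE => /eqP.
  rewrite addr_eq0 => /eqP xE.
  have nE j : x = (-1) ^+ j *: iter j (mcomp w v) x.
    elim: j => [|j IH]; first by rewrite scale1r.
    rewrite iterSr [mcomp w v x]mhE -[w (v x)]opprK -xE exprS mulN1r scaleNr.
    suff -> : iter j (mcomp w v) (- x) = - iter j (mcomp w v) x by rewrite scalerN opprK.
    by elim: j {IH} => //= j ->; rewrite linearN.
  by rewrite (nE k) nk scaler0.
apply: (@eq_bij _ _ (u \o madd (mhom_id M) (mcomp w v))).
  by apply: bij_comp => //; exists w.
by move=> x; rewrite /= !mhE linearD /= wK.
Qed.

(** The identity of N is the sum of its two parts through M and through M'; by locality one of them
    is invertible and splits N off that summand. *)
Lemma indecomposable_prime N M M' : indecomposable N ->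
  summand N (dsum2 M M') -> summand N M \/ summand N M'.
Proof.
move=> ind /summandP[i [p pi]].
have [q qE] := dsum2_pr1_exists M M'; have [j jE] := dsum2_in2_exists M M'.
pose u := mcomp (mcomp p (dsum2_inl M M')) (mcomp q i).
pose v := mcomp (mcomp p j) (mcomp (dsum2_snd M M') i).
have uv x : u x + v x = x.
  rewrite /u /v !mhE dsum2_inlE qE jE dsum2_sndE -(linearD p) -[RHS]pi.
  congr (p _); case: (i x) => y z; rewrite /=.
  by congr pair; rewrite /= ?addr0 ?add0r.
case: (indecomposable_local ind uv) => /mhom_bij_inv[w [uK _]].
  by left; apply: (@summand_intro _ _ (mcomp q i) (mcomp w (mcomp p (dsum2_inl M M')))) => x;
     rewrite -[RHS]uK /u !mhE.
by right; apply: (@summand_intro _ _ (mcomp (dsum2_snd M M') i) (mcomp w (mcomp p j))) => x;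
   rewrite -[RHS]uK /v !mhE.
Qed.

Lemma summand_indecomposable N M :
  indecomposable M -> ~ is_zero N -> summand N M -> isom N M.
Proof.
case=> _ ind N0 [N' /isom_sym iso]; case: (ind _ _ iso) => // z.
exact/isom_sym/(isom_trans iso)/isom_dsum2_zero.
Qed.

Lemma summand_zero N M : is_zero M -> summand N M -> is_zero N.
Proof.
move=> /is_zeroP M0 /summandP[i [p pi]]; apply/is_zeroP=> x.
by rewrite -(pi x) (M0 (i x)) linear0.
Qed.

Lemma dsum_prime N n F : indecomposable N -> summand N (dsum n F) ->
  exists2 i, (i < n)%N & summand N (F i).
Proof.
move=> ind; elim: n => [|n IH] /=.
  move/summand_zero=> z; have [[]] := ind; apply: z.
  by apply/is_zeroP=> x; apply/matrixP=> a [].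
by case/(indecomposable_prime ind) => [/IH[i ltin]|]; [exists i; rewrite // ltnS ltnW | exists n].
Qed.

Lemma summand_dsum n (F : nat -> lmodule A) i : (i < n)%N -> summand (F i) (dsum n F).
Proof.
elim: n => //= n IH; rewrite ltnS leq_eqVlt => /orP[/eqP ->|/IH s].
  exact: summand_dsum2r.
exact: summand_trans s (summand_dsum2l _ _).
Qed.

Lemma summand_dsum_pair n (F : nat -> lmodule A) i j :
  (i < j < n)%N -> summand (dsum2 (F i) (F j)) (dsum n F).
Proof.
elim: n => [|n IH] /=; first by rewrite andbF.
case/andP=> ij; rewrite ltnS leq_eqVlt => /orP[/eqP je|jn].
  by rewrite je in ij *; apply: summand_dsum2 (summand_refl _); apply: summand_dsum.
by apply: summand_trans (summand_dsum2l _ _); apply: IH; rewrite ij.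
Qed.

Lemma isom_dsum n (F G : nat -> lmodule A) : (forall i, (i < n)%N -> isom (F i) (G i)) ->
  isom (dsum n F) (dsum n G).
Proof.
elim: n => [|n IH] FG /=; first exact: isom_refl.
by apply: isom_dsum2; [apply: IH => i /ltnW|]; apply: FG.
Qed.

(** Gaussian elimination with the invertible corner u: [h] embeds R as the vectors whose image has
    first component 0, and [s] is the Schur complement. *)
Lemma cancel_component N R R' (phi : mhom (dsum2 N R) (dsum2 N R')) :
  bijective phi -> (exists u : mhom N N, bijective u /\ forall x, u x = (phi (x, 0)).1) ->
  isom R R'.
Proof.
move=> /mhom_bijP[phiI phiS] [u [/mhom_bij_inv[w [uK wK]] uE]].
have [q qE] := dsum2_pr1_exists N R'; have [j jE] := dsum2_in2_exists N R.
pose b := mcomp q (mcomp phi j).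
have [h hE] := pair_exists (mscale (-1) (mcomp w b)) (mhom_id R).
have hphi r : phi (h r) = (0, (phi (h r)).2).
  have -> : h r = - dsum2_inl N R (w (b r)) + j r.
    rewrite hE !mhE scaleN1r dsum2_inlE jE.
    by congr pair; rewrite /= ?addr0 ?oppr0 ?add0r.
  apply: injective_projections => //.
  by rewrite linearD linearN /= dsum2_inlE -uE wK /b !mhE qE addNr.
pose s := mcomp (dsum2_snd N R') (mcomp phi h).
exists s; apply/mhom_bijP; split=> [|r'].
  apply: mhom_injP => r; rewrite /s !mhE dsum2_sndE => s0.
  have : phi (h r) = 0 by rewrite hphi s0.
  by rewrite -(linear0 phi) => /phiI; rewrite hE !mhE => /(congr1 snd).
have [[n r] nr] := phiS (0, r'); exists r; rewrite /s !mhE dsum2_sndE.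
suff -> : h r = (n, r) by rewrite nr.
rewrite hE !mhE; congr pair; rewrite scaleN1r; apply: (can_inj uK).
rewrite linearN /= wK qE jE; apply/eqP; rewrite eq_sym -addr_eq0; apply/eqP.
rewrite uE.
have -> : (phi (n, 0)).1 + (phi (0, r)).1 = (phi (n, 0) + phi (0, r)).1 by [].
rewrite -(linearD phi) /= (_ : (n, 0) + (0, r) = (n, r)) ?nr //.
by congr pair; rewrite /= ?addr0 ?add0r.
Qed.

(** The corner a of phi may be singular. The upper left entry of psi phi = 1 reads a' a + b' c = 1,
    so by locality a or b' c is invertible, and a row operation reduces the second case to an
    invertible corner. *)
Lemma isom_cancel N R R' : indecomposable N ->
  isom (dsum2 N R) (dsum2 N R') -> isom R R'.
Proof.
move=> ind /isom_inv[phi [psi [phiK psiK]]].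
have [q qE] := dsum2_pr1_exists N R'; have [q' q'E] := dsum2_pr1_exists N R.
have [j' j'E] := dsum2_in2_exists N R'.
pose a := mcomp q (mcomp phi (dsum2_inl N R)).
pose a' := mcomp q' (mcomp psi (dsum2_inl N R')).
pose c := mcomp (dsum2_snd N R') (mcomp phi (dsum2_inl N R)).
pose b' := mcomp q' (mcomp psi j').
have id11 x : mcomp a' a x + mcomp b' c x = x.
  rewrite !mhE !q'E !qE !dsum2_sndE !dsum2_inlE j'E.
  have -> : forall y z : dsum2 N R, y.1 + z.1 = (y + z).1 by [].
  rewrite -(linearD psi) /= -[RHS]/((x, 0 : R).1) -[in RHS](phiK (x, 0)).
  congr (psi _).1; case: (phi (x, 0)) => y z.
  by congr pair; rewrite /= ?addr0 ?add0r.
case: (classic (bijective a)) => [ab|aN].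
  apply: (@cancel_component N R R' phi); first by exists psi.
  by exists a; split=> // x; rewrite /a !mhE qE dsum2_inlE.
have bc : bijective (mcomp b' c).
  case: (indecomposable_local ind id11) => // /mhom_bijP[a'aI _]; case: aN.
  by apply: mhom_endo_bij => x y xy; apply: a'aI; rewrite !(mcompE a' a) xy.
(* Adding [b' c] to the first component of [phi] makes its corner bijective. *)
have [s sE] := pair_exists (madd q (mcomp b' (dsum2_snd N R'))) (dsum2_snd N R').
have [t tE] := pair_exists (msub q (mcomp b' (dsum2_snd N R'))) (dsum2_snd N R').
have xE (x : dsum2 N R') : (q x, dsum2_snd N R' x) = x.
  by rewrite qE dsum2_sndE; case: x.
have qsE x : q (s x) = q x + b' (dsum2_snd N R' x) by rewrite qE sE [LHS]maddE mcompE.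
have qtE x : q (t x) = q x - b' (dsum2_snd N R' x) by rewrite qE tE [LHS]msubE mcompE.
have sndsE x : dsum2_snd N R' (s x) = dsum2_snd N R' x by rewrite dsum2_sndE sE.
have sndtE x : dsum2_snd N R' (t x) = dsum2_snd N R' x by rewrite dsum2_sndE tE.
have stK : cancel s t by move=> x; rewrite -[LHS]xE qtE qsE sndtE sndsE addrK.
have tsK : cancel t s by move=> x; rewrite -[LHS]xE qsE qtE sndsE sndtE subrK.
apply: (@cancel_component N R R' (mcomp s phi)).
  apply: (@eq_bij _ _ (s \o phi)); last by move=> x; rewrite mhE.
  by apply: bij_comp; [exists t | exists psi].
exists (madd (mcomp b' c) a); split; first exact: bij_add_nonbij.
move=> x; rewrite -qE (mcompE s phi) qsE maddE addrC.
by rewrite -dsum2_inlE !mcompE.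
Qed.

(** One copy of N lies in one of the two modules, say P = N + P1. Cancelling that copy leaves N as a
    summand of P1 + P', and primeness decides where the second copy lies. *)
Lemma square_summand N M M' : indecomposable N ->
  summand (dsum2 N N) (dsum2 M M') ->
  [\/ summand (dsum2 N N) M, summand (dsum2 N N) M' | summand N M /\ summand N M'].
Proof.
move=> ind.
suff H P P' : summand N P -> summand (dsum2 N N) (dsum2 P P') ->
    summand (dsum2 N N) P \/ (summand N P /\ summand N P').
  move=> s; have := summand_trans (summand_dsum2l N N) s.
  case/(indecomposable_prime ind) => [NM|NM'].
    by case: (H _ _ NM s); [constructor 1 | constructor 3].
  have s' := summand_trans s (isom_summand (dsum2C _ _)).
  by case: (H _ _ NM' s') => [|[]]; [constructor 2 | constructor 3].
move=> NP [R iso]; have [P1 isoP] := NP.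
have /(isom_cancel ind) iso1 : isom (dsum2 N (dsum2 N R)) (dsum2 N (dsum2 P1 P')).
  apply: isom_trans (dsum2A _ _ _) _; apply: isom_trans iso _.
  apply: isom_trans (isom_sym (dsum2A _ _ _)).
  exact: isom_dsum2 (isom_sym isoP) (isom_refl _).
have : summand N (dsum2 P1 P') by exists R.
case/(indecomposable_prime ind) => [s|s]; [left|by right].
apply: summand_trans (isom_summand isoP).
exact: summand_dsum2 (summand_refl _) s.
Qed.

Lemma indecomposable_square N M : indecomposable N -> indecomposable M ->
  ~ summand (dsum2 N N) M.
Proof.
move=> [N0 _] ind s; have [_ indM] := ind.
have nz : ~ is_zero (dsum2 N N) by move/summand_zero/(_ (summand_dsum2l N N)).
by case: (indM _ _ (isom_sym (summand_indecomposable ind nz s))).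
Qed.

Lemma indecomposable_summand_exists M : ~ is_zero M ->
  exists N, indecomposable N /\ summand N M.
Proof.
have [m] := ubnP (mdim M); elim: m M => // m IH M; rewrite ltnS => dM M0.
case: (classic (indecomposable M)) => [ind|nind].
  by exists M; split=> //; apply: summand_refl.
have [N [N' [iso [N0 N'0]]]] : exists N N', isom M (dsum2 N N') /\
    (~ is_zero N /\ ~ is_zero N').
  apply: NNPP => H; apply: nind; split=> // N N' iso.
  by apply: NNPP => /not_or_and h; apply: H; exists N, N'.
have dN : (mdim N < m)%N.
  rewrite (leq_trans _ dM) // ltn_neqAle.
  have [f [g [fK gK]]] := isom_inv iso.
  have iI : injective (mcomp g (dsum2_inl N N')).
    move=> x y; rewrite !mhE => /(can_inj gK); rewrite !dsum2_inlE.
    by case.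
  rewrite (mdim_inj iI) andbT; apply/negP=> /eqP /(mdim_inj_bij iI) b.
  apply: N'0; apply/is_zeroP=> y; have [_ S] := (mhom_bijP _).1 b.
  have [x] := S (g (0, y)); rewrite mhE => /(can_inj gK).
  by rewrite dsum2_inlE => -[].
have [S [indS sS]] := IH N dN N0; exists S; split=> //.
apply: summand_trans sS _; apply: summand_trans (summand_dsum2l N N') _.
exact/isom_summand/isom_sym.
Qed.

Lemma proper_complement_dim M N N' : isom (dsum2 N N') M -> ~ is_zero N ->
  (mdim N' < mdim M)%N.
Proof.
move=> /isom_inv[f [g [fK gK]]] N0; have [j jE] := dsum2_in2_exists N N'.
have iI : injective (mcomp f j).
  by move=> x y; rewrite !mhE => /(can_inj fK); rewrite !jE => -[].
rewrite ltn_neqAle (mdim_inj iI) andbT; apply/negP=> /eqP /(mdim_inj_bij iI) b.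
apply: N0; apply/is_zeroP=> x; have [_ S] := (mhom_bijP _).1 b.
by have [y] := S (f (x, 0)); rewrite mhE => /(can_inj fK); rewrite jE => -[].
Qed.

Lemma decomposition_exists M : exists m F,
  (forall i, (i < m)%N -> indecomposable (F i)) /\ isom M (dsum m F).
Proof.
have [d] := ubnP (mdim M); elim: d M => // d IH M; rewrite ltnS => dM.
case: (classic (is_zero M)) => [z|nz].
  exists 0%N, (fun=> M); split=> //=.
  apply: (isom_intro (f := mzero _ _) (g := mzero _ _)) => x; rewrite mzeroE.
    exact/esym/((is_zeroP M).1 z).
  by apply/matrixP=> a [].
have [N [ind [N' iso]]] := indecomposable_summand_exists nz.
have [N0 _] := ind.
have [m [F [indF isoF]]] := IH N' (leq_trans (proper_complement_dim iso N0) dM).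
exists m.+1, (fun i => if i == m then N else F i); split=> [i|/=].
  by rewrite ltnS leq_eqVlt; case: eqP => //= _; apply: indF.
rewrite eqxx; apply: isom_trans (isom_sym iso) _; apply: isom_trans (dsum2C _ _) _.
apply: isom_dsum2 (isom_refl _); apply: isom_trans isoF _.
by apply: isom_dsum => i ltim; rewrite ltn_eqF //; apply: isom_refl.
Qed.

(** This trades a chosen decomposition for a test on all indecomposables, which passes to summands
    at once. *)
Lemma basicP M :
  basic M <-> forall N, indecomposable N -> ~ summand (dsum2 N N) M.
Proof.
split=> [[m [F [indF isoF iso]]] N indN s|H].
  move/summand_trans: s => /(_ _ (isom_summand iso)) {M iso}.
  elim: m indF isoF => [|m IH] indF isoF /=.
    move/summand_zero=> z; case: indN => N0 _; apply: N0.
    apply: summand_zero (summand_dsum2l N N); apply: z.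
    by apply/is_zeroP=> x; apply/matrixP=> a [].
  case/(square_summand indN) => [||[sD sF]].
  - by apply: IH => [i /ltnW|i j /andP[ij /ltnW jm]]; [apply: indF | apply: isoF; rewrite ij].
  - exact/indecomposable_square/indF.
  have [i im sFi] := dsum_prime indN sD; have [N0 _] := indN.
  apply: (isoF i m); first by rewrite im ltnSn.
  apply: isom_trans (summand_indecomposable (indF m (ltnSn m)) N0 sF).
  by apply/isom_sym/summand_indecomposable => //; apply: indF; rewrite ltnS ltnW.
have [m [F [indF iso]]] := decomposition_exists M.
exists m, F; split=> // i j ijm FE; have /andP[ij jm] := ijm.
apply: (H (F i)); first by apply: indF; apply: ltn_trans jm.
apply: summand_trans (isom_summand (isom_sym iso)).
apply: summand_trans (summand_dsum_pair _ ijm).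
exact: summand_dsum2 (summand_refl _) (isom_summand FE).
Qed.

End KrullSchmidt.

(** * Vanishing of Ext and twists *)

Section Extensions.

Variables (K : fieldType) (A : falgType K).
Implicit Types L M N P S T : lmodule A.

Lemma retraction_of_section L M N (i : mhom L M) (p : mhom M N) (s : mhom N M) :
  short_exact i p -> (forall x, p (s x) = x) ->
  exists r : mhom M L, (forall x, r (i x) = x) /\ forall y, i (r y) = y - s (p y).
Proof.
move=> ex ps; have /short_exactP[iI exm pS] := ex.
have [r rE] : exists r : mhom M L, forall y,
    i (r y) = msub (mhom_id M) (mcomp s p) y.
  by apply: factor_through_inj => // y; apply/exm; rewrite !mhE linearB /= ps subrr.
exists r; split=> [x|y]; last by rewrite rE !mhE.
by apply: iI; rewrite rE !mhE (short_exact0 _ ex) linear0 subr0.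
Qed.

Lemma section_of_retraction L M N (i : mhom L M) (p : mhom M N) (r : mhom M L) :
  short_exact i p -> (forall x, r (i x) = x) ->
  exists s : mhom N M, forall x, p (s x) = x.
Proof.
move=> ex ri; have /short_exactP[iI exm pS] := ex.
have [s sE] : exists s : mhom N M, forall y,
    s (p y) = msub (mhom_id M) (mcomp i r) y.
  by apply: factor_through_surj => // y /exm[x <-]; rewrite !mhE ri subrr.
exists s => x; have [y <-] := pS x.
by rewrite sE !mhE linearB /= (short_exact0 _ ex) subr0.
Qed.

Lemma Ext1_zeroP M N : Ext1_zero M N <->
  forall E (i : mhom N E) (p : mhom E M), short_exact i p ->
    exists r : mhom E N, forall x, r (i x) = x.
Proof.
split=> [H E i p ex|H [E i p ex]].
  have [/= h [hi _]] := H (Extension ex).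
  have [q qE] := dsum2_pr1_exists N M.
  by exists (mcomp q h) => x; rewrite mhE qE; have /= -> := hi x; rewrite dsum2_inlE.
have [r ri] := H _ _ _ ex; have [s ps] := section_of_retraction ex ri.
have [h hE] := pair_exists r p.
exists h; split=> x.
  by rewrite -[RHS]/(dsum2_inl N M x) /= hE ri dsum2_inlE (short_exact0 _ ex).
by rewrite -[LHS]/(dsum2_snd N M (h x)) dsum2_sndE hE.
Qed.

Lemma Ext1_zero_sectionP M N : Ext1_zero M N <->
  forall E (i : mhom N E) (p : mhom E M), short_exact i p ->
    exists s : mhom M E, forall x, p (s x) = x.
Proof.
rewrite Ext1_zeroP; split=> H E i p ex.
  by have [r ri] := H _ _ _ ex; apply: section_of_retraction ri.
by have [s ps] := H _ _ _ ex; have [r [ri _]] := retraction_of_section ex ps; exists r.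
Qed.

(** Pull the sequence back along [h]: the kernel of (p, -h) on E + M is an extension of M by N, and
    a section of it, followed by the projection to E, is the lift. *)
Lemma Ext1_zero_lift M N E C (i : mhom N E) (p : mhom E C) (h : mhom M C) :
  Ext1_zero M N -> short_exact i p -> exists l : mhom M E, forall x, p (l x) = h x.
Proof.
move=> /Ext1_zero_sectionP ext ex; have /short_exactP[iI exm pS] := ex.
have [d dE] := copair_exists p (mscale (-1) h).
have [S [j [jI jE]]] := kernel_exists d.
have [q qE] := dsum2_pr1_exists E M.
have [i' i'E] : exists i' : mhom N S, forall x, j (i' x) = mcomp (dsum2_inl E M) i x.
  apply: factor_through_inj => // x; apply/jE.
  by rewrite mhE dE dsum2_inlE mhE /= (short_exact0 _ ex) linear0 scaler0 addr0.
have ex' : short_exact i' (mcomp (dsum2_snd E M) j).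
  apply/short_exactP; split=> [x y|y|m].
  - move/(congr1 j); rewrite !i'E !mhE !dsum2_inlE.
    by case=> /iI.
  - rewrite mhE dsum2_sndE; split=> [y2|[x <-]]; last by rewrite i'E mhE dsum2_inlE.
    have : d (j y) = 0 by apply/jE; exists y.
    rewrite dE mhE y2 linear0 scaler0 addr0 => /exm[x xE].
    exists x; apply: jI; rewrite i'E mhE dsum2_inlE xE -y2.
    by case: (j y).
  - have [e eE] := pS (h m).
    have /jE[s sE] : d (e, m) = 0 by rewrite dE mhE eE scaleN1r subrr.
    by exists s; rewrite mhE sE dsum2_sndE.
have [s sE] := ext _ _ _ ex'.
exists (mcomp q (mcomp j s)) => m; rewrite !mhE qE.
have : d (j (s m)) = 0 by apply/jE; exists (s m).
rewrite dE mhE scaleN1r => /eqP; rewrite subr_eq0 => /eqP ->.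
by rewrite -[in RHS](sE m) mhE dsum2_sndE.
Qed.

(** Dually, push out along [h]: the cokernel of (h, -i) is an extension of M by N, and a retraction
    of it restricts to E. *)
Lemma Ext1_zero_extend M N E Z (i : mhom Z E) (p : mhom E M) (h : mhom Z N) :
  Ext1_zero M N -> short_exact i p -> exists k : mhom E N, forall x, k (i x) = h x.
Proof.
move=> /Ext1_zeroP ext ex; have /short_exactP[iI exm pS] := ex.
have [d dE] := pair_exists h (mscale (-1) i).
have [Q [q [qS qE]]] := cokernel_exists d.
have [j jE] := dsum2_in2_exists N E.
have [p' p'E] : exists p' : mhom Q M, forall y, p' (q y) = mcomp p (dsum2_snd N E) y.
  apply: factor_through_surj => // y /qE[z <-].
  by rewrite mhE dsum2_sndE dE mhE linearZ /= (short_exact0 _ ex) scaler0.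
have ex' : short_exact (mcomp q (dsum2_inl N E)) p'.
  apply/short_exactP; split.
  - apply: mhom_injP => n; rewrite mhE dsum2_inlE => /qE[z].
    rewrite dE !mhE scaleN1r => -[<-] /eqP; rewrite oppr_eq0 => /eqP iz.
    by rewrite (iI z 0) ?linear0.
  - move=> y; split=> [|[x <-]]; last by rewrite mhE p'E mhE dsum2_sndE dsum2_inlE linear0.
    have [[n e] <-] := qS y; rewrite p'E mhE dsum2_sndE => /exm[z ze].
    exists (n + h z); rewrite mhE dsum2_inlE; apply/eqP; rewrite -subr_eq0 -linearB.
    apply/eqP/qE; exists z; rewrite dE mhE scaleN1r ze.
    by congr pair; rewrite /= ?sub0r // addrC addKr.
  - move=> m; have [e <-] := pS m; exists (q (0, e)).
    by rewrite p'E mhE dsum2_sndE.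
have [r rE] := ext _ _ _ ex'.
exists (mcomp r (mcomp q j)) => z; rewrite !mhE jE -[RHS]rE mhE dsum2_inlE.
congr (r _); apply/esym/eqP; rewrite -subr_eq0 -linearB; apply/eqP/qE; exists z.
by rewrite dE mhE scaleN1r; congr pair; rewrite /= ?subr0 ?sub0r.
Qed.

(** This is exactness of Hom(J, N) -> Hom(X, N) -> Ext^1(Y, N) -> Ext^1(J, N). A lift l of p to E
    restricts to a map X -> N; subtracting an extension of it to J makes l vanish on X, so it
    descends to a section. *)
Lemma Ext1_zero_quotient X J Y N (i : mhom X J) (p : mhom J Y) :
  short_exact i p -> Ext1_zero J N ->
  (forall h : mhom X N, exists k : mhom J N, forall x, k (i x) = h x) ->
  Ext1_zero Y N.
Proof.
move=> ex extJ extend; apply/Ext1_zero_sectionP => E j q exE.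
have /short_exactP[jI exj qS] := exE; have /short_exactP[iI exi pS] := ex.
have [l lE] := Ext1_zero_lift p extJ exE.
have [h hE] : exists h : mhom X N, forall x, j (h x) = mcomp l i x.
  by apply: factor_through_inj => // x; apply/exj; rewrite mhE lE (short_exact0 _ ex).
have [k kE] := extend h.
have [s sE] : exists s : mhom Y E, forall y, s (p y) = msub l (mcomp j k) y.
  apply: factor_through_surj => // y /exi[x <-].
  by rewrite !mhE kE hE mhE subrr.
exists s => y; have [z <-] := pS y.
by rewrite sE !mhE linearB /= lE (short_exact0 _ exE) subr0.
Qed.

Lemma Ext1_zero_summandl M M' N : summand M' M -> Ext1_zero M N -> Ext1_zero M' N.
Proof.
move=> /summandP[i [p pi]] ext; apply/Ext1_zero_sectionP => E j q ex.
have [l lE] := Ext1_zero_lift p ext ex.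
by exists (mcomp l i) => x; rewrite mhE lE pi.
Qed.

Lemma Ext1_zero_summandr M N N' : summand N' N -> Ext1_zero M N -> Ext1_zero M N'.
Proof.
move=> /summandP[i [p pi]] ext; apply/Ext1_zeroP => E j q ex.
have [k kE] := Ext1_zero_extend i ext ex.
by exists (mcomp p k) => x; rewrite mhE kE pi.
Qed.

Lemma Ext1_zero_dsum2l M M' N :
  Ext1_zero M N -> Ext1_zero M' N -> Ext1_zero (dsum2 M M') N.
Proof.
move=> e e'; apply/Ext1_zero_sectionP => E j q ex.
have [i iE] := dsum2_in2_exists M M'.
have [l lE] := Ext1_zero_lift (dsum2_inl M M') e ex.
have [l' l'E] := Ext1_zero_lift i e' ex.
have [s sE] := copair_exists l l'.
exists s => -[x y]; rewrite sE linearD /= lE l'E dsum2_inlE iE.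
by congr pair; rewrite /= ?addr0 ?add0r.
Qed.

Lemma Ext1_zero_dsum2r M N N' :
  Ext1_zero M N -> Ext1_zero M N' -> Ext1_zero M (dsum2 N N').
Proof.
move=> e e'; apply/Ext1_zeroP => E j q ex.
have [p pE] := dsum2_pr1_exists N N'.
have [k kE] := Ext1_zero_extend p e ex.
have [k' k'E] := Ext1_zero_extend (dsum2_snd N N') e' ex.
have [r rE] := pair_exists k k'.
by exists r => x; rewrite rE kE k'E pE dsum2_sndE; case: x.
Qed.

Lemma in_add_self T : in_add T T.
Proof. by exists 1%N; apply: summand_dsum2r. Qed.

Lemma in_add_summand T M N : summand N M -> in_add T M -> in_add T N.
Proof. by move=> s [k sk]; exists k; apply: summand_trans sk. Qed.

Lemma in_add_dsum2 T M N : in_add T M -> in_add T N -> in_add T (dsum2 M N).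
Proof.
move=> [k sk] [l sl]; exists (k + l)%N.
apply: summand_trans (summand_dsum2 sk sl) _ => {sk sl}.
elim: l => [|l IH].
  rewrite addn0; apply/isom_summand/isom_dsum2_zero.
  by apply/is_zeroP=> x; apply/matrixP=> a [].
rewrite addnS /=; apply: summand_trans (isom_summand (dsum2A _ _ _)) _.
exact: summand_dsum2 IH (summand_refl _).
Qed.

Lemma zero_moduleP : is_zero (zero_module A).
Proof. by apply/is_zeroP=> x; apply/matrixP=> a []. Qed.

Lemma in_add_zero T M : is_zero M -> in_add T M.
Proof.
move/is_zeroP=> z; exists 0%N.
by apply: (summand_intro (i := mzero _ _) (p := mzero _ _)) => x; rewrite mzeroE (z x).
Qed.

Lemma in_add_dsum T n (F : nat -> lmodule A) :
  (forall i, (i < n)%N -> in_add T (F i)) -> in_add T (dsum n F).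
Proof.
elim: n => [|n IH] H /=; first exact/in_add_zero/zero_moduleP.
by apply: in_add_dsum2; [apply: IH => i /ltnW|]; apply: H.
Qed.

Lemma in_add_trans S T M : in_add S T -> in_add T M -> in_add S M.
Proof. by move=> ST [k sk]; apply: in_add_summand sk _; apply: in_add_dsum. Qed.

Lemma indecomposable_in_add T N : indecomposable N -> in_add T N -> summand N T.
Proof. by move=> ind [k /(dsum_prime ind)[]]. Qed.

Lemma Ext1_zero_in_addl T M N : in_add T M -> Ext1_zero T N -> Ext1_zero M N.
Proof.
move=> [k sk] e; apply: Ext1_zero_summandl sk _; elim: k => [|k IH] /=.
  apply/Ext1_zero_sectionP => E i p _; exists (mzero _ _) => x.
  by rewrite mzeroE linear0 (proj1 (is_zeroP _) zero_moduleP x).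
exact: Ext1_zero_dsum2l.
Qed.

End Extensions.

(** * Transport of module properties along twists by automorphisms *)

Section Twists.

Variables (K : fieldType) (A : falgType K).
Implicit Types (L M N P S T : lmodule A) (phi psi : algaut A).

(** A twist changes the action but not the carrier, so the isomorphisms between twists below have
    the identity as underlying map. *)
Lemma isom_by_fun M N (f : M -> N) (g : N -> M) : linear f -> cancel f g -> cancel g f ->
  (forall a x, f (mact a x) = mact a (f x)) -> isom M N.
Proof.
by move=> lf fK gK /(mhom_exists lf)[h hE]; exists h, g => x; rewrite hE.
Qed.

Lemma twist_comp phi psi M :
  isom (twist (aut_comp phi psi) M) (twist phi (twist psi M)).
Proof.
apply: (@isom_by_fun (twist (aut_comp phi psi) M) (twist phi (twist psi M)) id id) => // a x.
by rewrite /= /twist_act /= comp_lfunE.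
Qed.

Lemma twist_id M : isom (twist (aut_id A) M) M.
Proof.
apply: (@isom_by_fun (twist (aut_id A) M) M id id) => // a x.
by rewrite /= /twist_act /= id_lfunE.
Qed.

Lemma twist_isom phi M N : isom M N -> isom (twist phi M) (twist phi N).
Proof.
case/isom_inv=> f [g [fK gK]].
exact: (@isom_intro _ _ _ _ (twist_hom phi f) (twist_hom phi g)).
Qed.

Lemma twist_invK phi M : isom (twist (aut_inv phi) (twist phi M)) M.
Proof.
apply: (@isom_by_fun (twist (aut_inv phi) (twist phi M)) M id id) => // a x.
by rewrite /= /twist_act /= autK.
Qed.

Lemma twist_dsum2 phi M N :
  isom (twist phi (dsum2 M N)) (dsum2 (twist phi M) (twist phi N)).
Proof. exact: (@isom_by_fun (twist phi (dsum2 M N)) (dsum2 (twist phi M) (twist phi N)) id id). Qed.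

Lemma twist_dsum phi n (F : nat -> lmodule A) :
  isom (twist phi (dsum n F)) (dsum n (fun i => twist phi (F i))).
Proof.
elim: n => [|n IH] /=; first exact: (@isom_by_fun (twist phi (zero_module A)) (zero_module A) id id).
exact: isom_trans (twist_dsum2 _ _ _) (isom_dsum2 IH (isom_refl _)).
Qed.

Lemma twist_summand phi M N : summand M N -> summand (twist phi M) (twist phi N).
Proof.
case=> P iso; exists (twist phi P).
exact: isom_trans (isom_sym (twist_dsum2 _ _ _)) (twist_isom _ iso).
Qed.

Lemma twist_in_add phi T M : in_add T M -> in_add (twist phi T) (twist phi M).
Proof.
case=> k /(twist_summand phi) s; exists k.
exact: summand_trans s (isom_summand (twist_dsum _ _ _)).
Qed.

Lemma twist_indecomposable phi M : indecomposable M -> indecomposable (twist phi M).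
Proof.
move=> [M0 ind]; split=> // N N' iso.
apply: (ind (twist (aut_inv phi) N) (twist (aut_inv phi) N')).
apply: isom_trans (isom_sym (twist_invK phi M)) _.
exact: isom_trans (twist_isom _ iso) (twist_dsum2 _ _ _).
Qed.

Lemma twist_short_exact phi L M N (f : mhom L M) (g : mhom M N) :
  short_exact f g -> short_exact (twist_hom phi f) (twist_hom phi g).
Proof. by []. Qed.

Lemma untwist_hom phi M N (h : mhom (twist phi M) (twist phi N)) :
  exists k : mhom M N, twist_hom phi k =1 h.
Proof.
apply: mhom_exists => [|a x]; first exact: linearP.
by have := mhomE h (phi a) x; rewrite /= /twist_act /= autK.
Qed.

End Twists.

(** * Frobenius forms and the trace pairing *)

Section LinearAlgebra.

Variables (K : fieldType) (V : vectType K).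

(** P need not be decidable: a subspace inside P is enlarged by a line as long as some vector of P
    lies outside it, and the codimension bounds the number of steps. *)
Lemma subspace_exists (P : V -> Prop) : P 0 ->
  (forall k x y, P x -> P y -> P (k *: x + y)) ->
  exists U : {vspace V}, forall x, x \in U <-> P x.
Proof.
move=> P0 Plin.
suff H m (U : {vspace V}) : (\dim (fullv : {vspace V}) - \dim U < m)%N ->
    (forall x, x \in U -> P x) -> exists U : {vspace V}, forall x, x \in U <-> P x.
  by apply: (H _ 0%VS (ltnSn _)) => x; rewrite memv0 => /eqP ->.
elim: m U => // m IH U dU UP.
case: (classic (exists x, P x /\ x \notin U)) => [[x [Px xU]]|nx]; last first.
  exists U => x; split=> [/UP//|Px]; apply/negPn/negP => xU.
  by apply: nx; exists x.
apply: (IH (<[x]> + U)%VS) => [|y /memv_addP[_ /vlineP[k ->] [u /UP Pu ->]]]; last exact: Plin.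
rewrite -ltnS (leq_trans _ dU) // ltnS; apply: ltn_sub2l.
  rewrite ltn_neqAle dimvS ?subvf // andbT; apply: contra xU => /eqP dU'.
  by have /eqP -> : U == fullv by [rewrite eqEdim subvf dU' leqnn]; rewrite memvf.
rewrite ltn_neqAle dimvS ?addvSr // andbT; apply: contra xU => /eqP dU'.
have /eqP -> : U == (<[x]> + U)%VS by rewrite eqEdim addvSr -dU' leqnn.
by apply: (subvP (addvSl _ _)); apply: memv_line.
Qed.

Lemma coordinates_exist : exists k (F : 'I_k -> 'Hom(V, K^o)),
  forall x, (forall i, F i x = 0) -> x = 0.
Proof.
have H i : exists F : 'Hom(V, K^o), F =1 coord (vbasis (fullv : {vspace V})) i.
  by apply: linear_fun_exists => k x y; rewrite linearP.
have [F FE] := fin_all_exists H.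
exists _, F => x x0; rewrite [x](coord_vbasis (memvf x)).
by apply: big1 => i _; rewrite -FE x0 scale0r.
Qed.

Lemma functional_separation (U : {vspace V}) w : w \notin U ->
  exists F : 'Hom(V, K^o), (forall u, u \in U -> F u = 0) /\ F w <> 0.
Proof.
move=> wU; set q := daddv_pi (U^C)%VS U.
have VU : (U^C :&: U = 0)%VS by rewrite capvC capv_compl.
have qD x : q x + daddv_pi U (U^C)%VS x = x.
  by rewrite daddv_pi_add // addvC addv_complf memvf.
have qU u : u \in U -> q u = 0.
  move=> uU; apply: (addIr u); rewrite add0r -[RHS]qD; congr (_ + _).
  by rewrite daddv_pi_id // capv_compl.
have qw : q w != 0.
  by apply: contra wU => /eqP qw; rewrite -[w]qD qw add0r memv_pi.
have [k [F F0]] := coordinates_exist.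
have [i Fi] : exists i, F i (q w) <> 0.
  apply: NNPP => H; move/eqP: qw; apply; apply: F0 => i; apply: NNPP => Fi.
  by apply: H; exists i.
exists (F i \o q)%VF; split=> [u uU|]; last by rewrite comp_lfunE.
by rewrite comp_lfunE qU // linear0.
Qed.

End LinearAlgebra.

(** * Frobenius forms, dual bases and functionals *)

Section Duality.

Variables (K : fieldType) (A : falgType K).
Implicit Types (L M N P J : lmodule A) (eta : algaut A) (lam : 'Hom(A, K^o)).

(** The map sending x to lam (x -) identifies A with its dual, and [rep] is the inverse. The first
    clause is what is left of commutativity: a factor changes sides at the price of [eta]. *)
Definition frobenius_form eta lam (rep : 'Hom(A, K^o) -> A) :=
  [/\ forall a y, lam (eta a * y) = lam (y * a),
      forall x, (forall y, lam (x * y) = 0) -> x = 0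
    & forall phi y, lam (rep phi * y) = phi y].

(** The form is the functional that corresponds to 1. Right linearity sends lam x to x, left
    linearity sends a lam to eta a, hence a lam = lam (eta a). *)
Lemma nakayama_frobenius eta : nakayama_automorphism eta ->
  exists lam rep, frobenius_form eta lam rep.
Proof.
case=> f [g fK gK]; pose lam : 'Hom(A, K^o) := g 1.
have fR x : f (dual_ract x lam) = x.
  by have := bhomE f x lam; rewrite /= /lam gK /= mul1r.
have fL a : f (dual_lact a lam) = eta a.
  by have := mhomE f a lam; rewrite /= /twist_act /= /lam gK mulr1.
have lamR x y : dual_ract x lam y = lam (x * y) by rewrite comp_lfunE lfunE.
have lamL x y : dual_lact x lam y = lam (y * x) by rewrite comp_lfunE lfunE.
exists lam, f; split=> [a y|x x0|phi y].
- have e : dual_ract (eta a) lam = dual_lact a lam by apply: (can_inj fK); rewrite fR fL.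
  by rewrite -lamR e lamL.
- rewrite -(fR x) (_ : dual_ract x lam = 0) ?linear0 //.
  by apply/lfunP=> y; rewrite lamR x0 zero_lfunE.
- have e : dual_ract (f phi) lam = phi by apply: (can_inj fK); rewrite fR.
  by rewrite -lamR e.
Qed.

Lemma regular_hom M (m : M) : exists h : mhom (regular A) M, forall a, h a = mact a m.
Proof.
apply: mhom_exists => [k a b|a b]; first exact: mact_linear_l.
exact: mactM.
Qed.

Definition act_on M (m : M) (a : A) : M := mact a m.
HB.instance Definition _ M (m : M) :=
  GRing.isLinear.Build K A M _ (act_on m) (mact_linear_l m).

(** This is the adjunction between functionals on M and A-linear maps from M to the dual of A, the
    latter read as the twist of A by the inverse of [eta]. *)
Lemma functional_hom eta lam rep M (phi : 'Hom(M, K^o)) :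
  frobenius_form eta lam rep ->
  exists h : mhom M (twist (aut_inv eta) (regular A)),
    forall m y, lam (h m * y) = phi (mact y m).
Proof.
case=> lamC lam0 repE.
pose psi m : 'Hom(A, K^o) := (phi \o linfun (act_on m))%VF.
have psiE m y : psi m y = phi (mact y m) by rewrite comp_lfunE lfunE.
have uniq x y : (forall z, lam (x * z) = lam (y * z)) -> x = y.
  move=> xy; apply/eqP; rewrite -subr_eq0; apply/eqP/lam0 => z.
  by rewrite mulrBl linearB /= xy subrr.
have hE : exists h : mhom M (twist (aut_inv eta) (regular A)),
    h =1 (fun m => rep (psi m)).
  apply: mhom_exists => [k x y|a x]; apply: uniq => z.
    transitivity (lam ((k *: (rep (psi x) : A) + rep (psi y)) * z)); last by [].
    by rewrite mulrDl -scalerAl linearP /= !repE !psiE !linearP.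
  by rewrite /= /twist_act /= -mulrA lamC -mulrA !repE !psiE mactM.
by case: hE => h hE; exists h => m y; rewrite hE repE psiE.
Qed.

(** Applying the inverse of [eta] to the values untwists the map of [functional_hom]. So A
    cogenerates: maps to A separate the points of every module. *)
Lemma regular_hom_detects eta lam rep M (phi : 'Hom(M, K^o)) :
  frobenius_form eta lam rep ->
  exists p : mhom M (regular A), forall x, p x = 0 -> phi x = 0.
Proof.
move=> frob; have [h hE] := functional_hom phi frob.
have [p pE] : exists p : mhom M (regular A), p =1 (fun x => aut_inv eta (h x)).
  apply: mhom_exists => [c x y|a x]; first by rewrite !linearP.
  by rewrite mhomE /= /twist_act /= rmorphM /= autK.
exists p => x; rewrite pE => hx.
have h0 : h x = 0.
  by rewrite -[h x](autVK eta) /= -[aut_invval eta _]/(aut_inv eta (h x)) hx linear0.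
by rewrite -(mact1 x) -hE h0 mul0r linear0.
Qed.

(** The families are the components of an embedding of J into a free module of rank k and of a
    retraction onto J. *)
Definition dual_basis J k (pi : 'I_k -> mhom J (regular A))
    (iota : 'I_k -> mhom (regular A) J) :=
  forall x, \sum_i iota i (pi i x) = x.

Section FreeModule.

Variable k : nat.

Definition free_act (a : A) (x : {ffun 'I_k -> A}) : {ffun 'I_k -> A} :=
  [ffun i => a * x i].

Lemma free_act_linear a : linear (free_act a).
Proof. by move=> c x y; apply/ffunP=> i; rewrite !ffunE mulrDr scalerAr. Qed.

Lemma free_act_linear_l x : linear (free_act^~ x).
Proof. by move=> c a b; apply/ffunP=> i; rewrite !ffunE mulrDl scalerAl. Qed.

Lemma free_act1 x : free_act 1 x = x.
Proof. by apply/ffunP=> i; rewrite !ffunE mul1r. Qed.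

Lemma free_actM a b x : free_act (a * b) x = free_act a (free_act b x).
Proof. by apply/ffunP=> i; rewrite !ffunE mulrA. Qed.

Definition free_module : lmodule A :=
  LModule free_act_linear free_act_linear_l free_act1 free_actM.

End FreeModule.

(** One map to A for each linear coordinate embeds J into a free module, and injectivity of J
    retracts it. *)
Lemma injective_dual_basis eta lam rep J : frobenius_form eta lam rep ->
  injective_module J -> exists k (pi : 'I_k -> mhom J (regular A)) iota,
    dual_basis pi iota.
Proof.
move=> frob injJ.
have [k [F F0]] := coordinates_exist J.
have [pi piE] := fin_all_exists (fun i => regular_hom_detects (F i) frob).
have [j jE] : exists j : mhom J (free_module k), j =1 (fun x => [ffun i => pi i x]).
  apply: mhom_exists => [c x y|a x]; apply/ffunP => i; rewrite !ffunE ?linearP //.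
  by rewrite mhomE.
have jI : injective j.
  apply: mhom_injP => x; rewrite jE => /ffunP x0; apply: F0 => i; apply: piE.
  by have := x0 i; rewrite !ffunE.
have [r rE] := injJ _ _ j (mhom_id J) jI.
have inc i : exists p : mhom (regular A) (free_module k),
    p =1 (fun a => [ffun l => if l == i then a else 0]).
  apply: mhom_exists => [c a b|a b]; apply/ffunP => l; rewrite !ffunE.
    by case: eqP => // _; rewrite scaler0 addr0.
  by case: eqP => // _; rewrite mulr0.
have [i iE] := fin_all_exists inc.
exists k, pi, (fun l => mcomp r (i l)) => x.
under eq_bigr => l _ do rewrite mcompE.
rewrite -linear_sum /= -[RHS](midE x) -rE /= jE; congr (r _).
apply/ffunP=> l; rewrite sum_ffunE ffunE (bigD1 l) //= iE ffunE eqxx big1 ?addr0 //.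
by move=> l' /negbTE ll'; rewrite iE ffunE eq_sym ll'.
Qed.

Lemma dual_basis_act J k (pi : 'I_k -> mhom J (regular A)) iota x :
  dual_basis pi iota -> \sum_i mact (pi i x : A) (iota i 1) = x.
Proof.
move=> db; rewrite -[RHS]db; apply: eq_bigr => i _.
by rewrite -mhomE /= mulr1.
Qed.

Lemma dual_basis_Ext1_zero J k (pi : 'I_k -> mhom J (regular A)) iota N :
  dual_basis pi iota -> Ext1_zero J N.
Proof.
move=> db; apply/Ext1_zero_sectionP => E i p ex.
have /short_exactP[_ _ pS] := ex.
have [e eE] := fin_all_exists (fun l => pS (iota l 1)).
have [s sE] : exists s : mhom J E, s =1 (fun x => \sum_l mact (pi l x : A) (e l)).
  apply: mhom_exists => [c x y|a x].
    rewrite scaler_sumr -big_split; apply: eq_bigr => l _ /=.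
    by rewrite linearP mactDl mactZl.
  rewrite linear_sum; apply: eq_bigr => l _ /=.
  by rewrite (mhomE (pi l) a x) /= mactM.
exists s => x; rewrite sE linear_sum -[RHS](dual_basis_act x db).
by apply: eq_bigr => l _ /=; rewrite mhomE eE.
Qed.

(** [w] stands for a morphism from J to its twist by the inverse of [eta]. It is a bare function
    because both have the same carrier, so composites through other modules fit in directly. *)
Definition trace_form lam J k (pi : 'I_k -> mhom J (regular A))
    (iota : 'I_k -> mhom (regular A) J) (w : J -> J) : K :=
  \sum_i lam (pi i (w (iota i 1))).

Lemma eq_trace_form lam J k (pi : 'I_k -> mhom J (regular A)) iota (w w' : J -> J) :
  w =1 w' -> trace_form lam pi iota w = trace_form lam pi iota w'.
Proof. by move=> ww'; apply: eq_bigr => i _; rewrite ww'. Qed.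

(** * The trace pairing between Hom(J, M) and Hom(M, nu J) *)

Section Pairing.

Variables (eta : algaut A) (lam : 'Hom(A, K^o)) (rep : 'Hom(A, K^o) -> A).
Implicit Types k : nat.

Lemma twisted_coordinate J k (pi : 'I_k -> mhom J (regular A)) M (v : mhom M (twist (aut_inv eta) J)) i a m :
  pi i (v (mact a m)) = eta a * pi i (v m).
Proof. by rewrite (mhomE v) /=; apply: (mhomE (pi i)). Qed.

(** In matrix entries the two sides are sums of lam (eta c * e) and lam (e * c). The factor [eta]
    arises because v is linear only up to [eta], and it is just what the Frobenius form absorbs. *)
Lemma trace_form_cyclic J k (pi : 'I_k -> mhom J (regular A)) (iota : 'I_k -> mhom (regular A) J)
    J' k' (pi' : 'I_k' -> mhom J' (regular A)) iota'
    (d : mhom J J') (v : mhom J' (twist (aut_inv eta) J)) :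
  frobenius_form eta lam rep -> dual_basis pi iota -> dual_basis pi' iota' ->
  trace_form lam pi iota (fun x => v (d x)) =
  trace_form lam pi' iota' (fun x => d (v x)).
Proof.
case=> lamC _ _ db db'.
pose c i j : A := pi' j (d (iota i 1)); pose e i j : A := pi i (v (iota' j 1)).
transitivity (\sum_i \sum_j lam (e i j * c i j)).
  apply: eq_bigr => i _; rewrite -{1}(dual_basis_act (d (iota i 1)) db') !linear_sum.
  apply: eq_bigr => j _ /=.
  by rewrite -lamC -twisted_coordinate.
rewrite exchange_big; apply: eq_bigr => j _ /=.
rewrite -{1}(dual_basis_act (v (iota' j 1) : J) db) !linear_sum.
apply: eq_bigr => i _ /=; congr (lam _).
by rewrite (mhomE d) (mhomE (pi' j)).
Qed.

(** Testing with u x = pi_i(x) m' gives lam (pi_i (v m')) = 0 for every m'. Taking m' = y m turns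
    this into lam (pi_i (v m) * y) = 0 for all y, so each coordinate of v m vanishes. *)
Lemma trace_pairing_nondegenerate J k (pi : 'I_k -> mhom J (regular A)) (iota : 'I_k -> mhom (regular A) J)
    M (v : mhom M (twist (aut_inv eta) J)) :
  frobenius_form eta lam rep -> dual_basis pi iota ->
  (forall u : mhom J M, trace_form lam pi iota (fun x => v (u x)) = 0) ->
  forall m, v m = 0.
Proof.
move=> [lamC lam0 _] db H m.
have lam1 i m' : lam (pi i (v m')) = 0.
  have [h hE] := regular_hom m'.
  have := H (mcomp h (pi i)); rewrite /trace_form => H'.
  rewrite -(dual_basis_act (v m' : J) db) !linear_sum -[RHS]H'.
  apply: eq_bigr => j _ /=.
  by rewrite (mhomE (pi i)) mcompE hE twisted_coordinate lamC.
have pi0 i : pi i (v m) = 0.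
  by apply: lam0 => y; rewrite -lamC -twisted_coordinate lam1.
rewrite -[LHS](dual_basis_act (v m : J) db); apply: big1 => i _.
by rewrite pi0 mact0l.
Qed.

(** The functional m |-> F (x |-> pi_i(x) m) is represented by a map h_i from M to the twisted A,
    and v is the sum of the iota_i h_i. *)
Lemma trace_pairing_surjective J k (pi : 'I_k -> mhom J (regular A)) (iota : 'I_k -> mhom (regular A) J)
    M (F : 'Hom('Hom(J, M), K^o)) :
  frobenius_form eta lam rep -> dual_basis pi iota ->
  exists v : mhom M (twist (aut_inv eta) J), forall u : mhom J M,
    trace_form lam pi iota (fun x => v (u x)) = F u.
Proof.
move=> frob db.
have elem i m : exists u : mhom J M, forall x, u x = mact (pi i x : A) m.
  have [h hE] := regular_hom m.
  by exists (mcomp h (pi i)) => x; rewrite mcompE hE.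
have Phi i : exists phi : 'Hom(M, K^o), forall m (u : mhom J M),
    (forall x, u x = mact (pi i x : A) m) -> phi m = F u.
  pose G m : 'Hom(J, M) := (linfun (act_on m) \o pi i)%VF.
  have GE m x : G m x = mact (pi i x : A) m by rewrite comp_lfunE lfunE.
  have [phi phiE] : exists phi : 'Hom(M, K^o), phi =1 (fun m => F (G m)).
    apply: linear_fun_exists => c x y.
    have -> : G (c *: x + y) = c *: G x + G y.
      by apply/lfunP => z; rewrite add_lfunE scale_lfunE !GE linearP.
    by rewrite linearP.
  exists phi => m u uE; rewrite phiE; congr (F _).
  by apply/lfunP => x; rewrite GE uE.
have [phi phiE] := fin_all_exists Phi.
have [h hE] := fin_all_exists (fun i => functional_hom (phi i) frob).
have [v vE] : exists v : mhom M (twist (aut_inv eta) J),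
    v =1 (fun m => \sum_i iota i (h i m)).
  apply: mhom_exists => [c x y|a m].
    rewrite scaler_sumr -big_split; apply: eq_bigr => l _ /=.
    by rewrite !linearP.
  rewrite linear_sum; apply: eq_bigr => l _ /=.
  by rewrite (mhomE (h l)); apply: (mhomE (iota l)).
exists v => u.
have lamE i m (w : mhom J M) : (forall x, w x = mact (pi i x : A) m) ->
    lam (h i m) = F w.
  by move=> /phiE <-; rewrite -[RHS](congr1 (phi i) (mact1 m)) -hE mulr1.
transitivity (\sum_l trace_form lam pi iota (fun x => iota l (h l (u x)))).
  rewrite exchange_big; apply: eq_bigr => j _ /=.
  by rewrite vE !linear_sum.
(* With A as its own dual basis of rank one, cyclicity collapses the trace over J of a map through A
   to a single value of [lam]. *)
pose one := fun _ : 'I_1 => mhom_id (regular A).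
have one_basis : dual_basis one one.
  by move=> x; rewrite big_ord1 /one !midE.
transitivity (\sum_l lam (h l (u (iota l 1)))).
  apply: eq_bigr => l _.
  have := @trace_form_cyclic _ _ one one J k pi iota (iota l) (mcomp (h l) u).
  move=> /(_ frob one_basis db); rewrite /trace_form big_ord1 /one !midE mcompE => ->.
  by apply: eq_bigr => j _; rewrite mcompE.
transitivity (\sum_l F (mcomp u (mcomp (iota l) (pi l)))).
  apply: eq_bigr => l _; apply: lamE => x; rewrite !mcompE -mhomE.
  by rewrite -(mhomE (iota l)) /= mulr1.
rewrite -linear_sum /=; congr (F _); apply/lfunP => x.
rewrite sum_lfunE -[in RHS](db x) linear_sum.
by apply: eq_bigr => l _; rewrite !mcompE.
Qed.

End Pairing.
End Duality.

(** * The twisted 2-Calabi-Yau property *)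

Section SerreDuality.

Variables (K : fieldType) (A : falgType K).
Implicit Types (L M N J H : lmodule A) (B P : bimodule A).

Lemma mhom_space_exists M N : exists U : {vspace 'Hom(M, N)},
  forall f : 'Hom(M, N), f \in U <-> exists u : mhom M N, f = u.
Proof.
have [||U UE] := @subspace_exists K 'Hom(M, N) (fun f => exists u : mhom M N, f = u).
- by exists (mzero M N); apply/lfunP => x; rewrite [RHS]mzeroE zero_lfunE.
- move=> k f g [u ->] [v ->]; exists (madd (mscale k u) v).
  by apply/lfunP => x; rewrite [RHS]maddE [in RHS]mscaleE add_lfunE scale_lfunE.
by exists U.
Qed.

(* The trace pairing makes [Hom(M, nu J_0) -> Hom(M, nu J_1) -> Hom(M, nu J_2)]
   dual to [Hom(J_2, M) -> Hom(J_1, M) -> Hom(J_0, M)]. *)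
Lemma exactness_duality eta lam rep J0 J1 J2 M k0 k1 k2
  (pi0 : 'I_k0 -> mhom J0 (regular A)) iota0
  (pi1 : 'I_k1 -> mhom J1 (regular A)) iota1
  (pi2 : 'I_k2 -> mhom J2 (regular A)) iota2
  (d0 : mhom J0 J1) (d1 : mhom J1 J2) :
  @frobenius_form K A eta lam rep ->
  dual_basis pi0 iota0 -> dual_basis pi1 iota1 -> dual_basis pi2 iota2 ->
  (forall v : mhom M (twist (aut_inv eta) J1), (forall m, d1 (v m) = 0) ->
     exists v0 : mhom M (twist (aut_inv eta) J0), forall m, d0 (v0 m) = v m) ->
  forall w : mhom J1 M, (forall x, w (d0 x) = 0) ->
  exists u : mhom J2 M, forall x, u (d1 x) = w x.
Proof.
move=> frob db0 db1 db2 ex w wd0.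
have [U UE] := mhom_space_exists J2 M.
have [pre preE] : exists pre : 'Hom('Hom(J2, M), 'Hom(J1, M)),
    pre =1 (fun f => (f \o d1)%VF).
  by apply: linear_fun_exists => k f g; rewrite comp_lfunDl comp_lfunZl.
pose R := (pre @: U)%VS.
have RE f : f \in R <-> exists u : mhom J2 M, f = (u \o d1)%VF.
  split=> [/memv_imgP[g /UE[u ->] ->]|[u ->]]; first by exists u; rewrite preE.
  by apply/memv_imgP; exists (mhom_val u); [apply/UE; exists u | rewrite preE].
case: (boolP (mhom_val w \in R)) => [/RE[u wE]|wR].
  by exists u => x; rewrite wE comp_lfunE.
(* If w is not of the form u d1, the separating F is the pairing with some v. Nondegeneracy gives d1
   v = 0, so v = d0 v0, and by cyclicity F w is the trace of v0 w d0 = 0. *)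
have [F [F0 Fw]] := functional_separation wR.
have [v vE] := trace_pairing_surjective F frob db1.
have d1v m : d1 (v m) = 0.
  pose dv : mhom M (twist (aut_inv eta) J2) := mcomp (twist_hom (aut_inv eta) d1) v.
  have dvE m' : dv m' = d1 (v m') by exact: mcompE.
  rewrite -dvE; apply: (trace_pairing_nondegenerate frob db2) => u.
  transitivity (trace_form lam pi2 iota2 (fun x => d1 (mcomp v u x))).
    by apply: eq_trace_form => x; rewrite dvE mcompE.
  rewrite -(trace_form_cyclic _ _ frob db1 db2).
  transitivity (trace_form lam pi1 iota1 (fun x => v (mcomp u d1 x))).
    by apply: eq_trace_form => x; rewrite !mcompE.
  by rewrite vE F0 //; apply/RE; exists u; apply/lfunP => x; rewrite [LHS]mcompE comp_lfunE.
have [v0 v0E] := ex v d1v.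
case: Fw; rewrite -vE.
transitivity (trace_form lam pi1 iota1 (fun x => d0 (mcomp v0 w x))).
  by apply: (@eq_trace_form K A lam J1 k1 pi1 iota1) => x; rewrite mcompE v0E.
rewrite -(trace_form_cyclic d0 (mcomp v0 w) frob db0 db1); apply: big1 => i _.
by rewrite mcompE wd0 !linear0.
Qed.

Definition lmult M (a : A) : 'Hom(M, M) := linfun (@mact K A M a).
Lemma lmultE M a x : lmult M a x = mact a x.
Proof. exact: lfunE. Qed.

HB.instance Definition _ B a :=
  GRing.isLinear.Build K B B _ (@ract K A B a) (@ract_linear K A B a).

Definition rmult B (a : A) : 'Hom(B, B) := linfun (@ract K A B a).
Lemma rmultE B a x : rmult B a x = ract a x.
Proof. exact: lfunE. Qed.

(** * Hom modules out of bimodules *)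

Section Coinduced.

Variables (B : bimodule A) (N : lmodule A).

Definition coind_act (a : A) (f : 'Hom(B, N)) : 'Hom(B, N) := (f \o rmult B a)%VF.

Lemma coind_actE a f x : coind_act a f x = f (ract a x).
Proof. by rewrite comp_lfunE rmultE. Qed.

Lemma coind_act_linear a : linear (coind_act a).
Proof. by move=> k f g; rewrite /coind_act comp_lfunDl comp_lfunZl. Qed.

Lemma coind_act_linear_l f : linear (coind_act^~ f).
Proof.
move=> k a b; apply/lfunP => x.
by rewrite add_lfunE scale_lfunE !coind_actE ract_linear_l linearP.
Qed.

Lemma coind_act1 f : coind_act 1 f = f.
Proof. by apply/lfunP => x; rewrite coind_actE ract1. Qed.

Lemma coind_actM a b f : coind_act (a * b) f = coind_act a (coind_act b f).
Proof. by apply/lfunP => x; rewrite !coind_actE ractM. Qed.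

Definition coind : lmodule A :=
  LModule coind_act_linear coind_act_linear_l coind_act1 coind_actM.

(** Hom_A(B, N) is described as a submodule of all K-linear maps: there the action is a plain
    formula, and [ev] recovers the underlying map. *)
Definition is_hom_module H (ev : mhom H coind) :=
  injective ev /\
  forall f : 'Hom(B, N), (exists h, ev h = f) <-> exists u : mhom B N, f = u.

Lemma hom_module_exists : exists H (ev : mhom H coind), is_hom_module ev.
Proof.
have [U UE] := mhom_space_exists B N.
have [|H [ev [evI evE]]] := @submodule_exists K A coind U.
  move=> a f /UE[u ->]; apply/UE.
  have eqv b x : coind_act a u (mact b x) = mact b (coind_act a u x).
    by rewrite !coind_actE lract mhomE.
  by exists (MHom eqv).
by exists H, ev; split=> // f; rewrite -evE UE.
Qed.

End Coinduced.

Section HomBimodule.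

Variables M N : lmodule A.

Definition hom_lact (a : A) (f : 'Hom(M, N)) : 'Hom(M, N) := (lmult N a \o f)%VF.
Definition hom_ract (a : A) (f : 'Hom(M, N)) : 'Hom(M, N) := (f \o lmult M a)%VF.

Lemma hom_lactE a f x : hom_lact a f x = mact a (f x).
Proof. by rewrite comp_lfunE lmultE. Qed.
Lemma hom_ractE a f x : hom_ract a f x = f (mact a x).
Proof. by rewrite comp_lfunE lmultE. Qed.

Lemma hom_lact_linear a : linear (hom_lact a).
Proof. by move=> k f g; rewrite /hom_lact comp_lfunDr comp_lfunZr. Qed.

Lemma hom_lact_linear_l f : linear (hom_lact^~ f).
Proof.
move=> k a b; apply/lfunP => x.
by rewrite add_lfunE scale_lfunE !hom_lactE mact_linear_l.
Qed.

Lemma hom_lact1 f : hom_lact 1 f = f.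
Proof. by apply/lfunP => x; rewrite hom_lactE mact1. Qed.

Lemma hom_lactM a b f : hom_lact (a * b) f = hom_lact a (hom_lact b f).
Proof. by apply/lfunP => x; rewrite !hom_lactE mactM. Qed.

Lemma hom_ract_linear a : linear (hom_ract a).
Proof. by move=> k f g; rewrite /hom_ract comp_lfunDl comp_lfunZl. Qed.

Lemma hom_ract_linear_l f : linear (hom_ract^~ f).
Proof.
move=> k a b; apply/lfunP => x.
by rewrite add_lfunE scale_lfunE !hom_ractE mact_linear_l linearP.
Qed.

Lemma hom_ract1 f : hom_ract 1 f = f.
Proof. by apply/lfunP => x; rewrite hom_ractE mact1. Qed.

Lemma hom_ractM a b f : hom_ract (a * b) f = hom_ract b (hom_ract a f).
Proof. by apply/lfunP => x; rewrite !hom_ractE mactM. Qed.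

Lemma hom_lract a b f : hom_ract b (hom_lact a f) = hom_lact a (hom_ract b f).
Proof. by apply/lfunP => x; rewrite hom_ractE !hom_lactE hom_ractE. Qed.

(** This is the test object for projectivity of bimodules: bimodule maps from P to it are the same
    as A-linear maps from M to Hom_A(P, N). *)
Definition hom_bimodule : bimodule A :=
  @Bimodule K A
    (LModule hom_lact_linear hom_lact_linear_l hom_lact1 hom_lactM)
    hom_ract hom_ract_linear hom_ract_linear_l hom_ract1 hom_ractM hom_lract.

End HomBimodule.

Lemma bhom_exists B B' (f : B -> B') : linear f ->
  (forall a x, f (mact a x) = mact a (f x)) ->
  (forall a x, f (ract a x) = ract a (f x)) -> exists h : bhom B B', h =1 f.
Proof.
move=> lf lE rE; have [h hE] := mhom_exists lf lE.
have eqv a x : h (ract a x) = ract a (h x) by rewrite !hE rE.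
by exists (BHom eqv).
Qed.

Lemma bprojective_lift P B B' (p : bhom B B') (f : bhom P B') :
  bprojective P -> (forall y, exists x, p x = y) -> exists g : bhom P B, forall x, p (g x) = f x.
Proof.
move=> proj pS; have [|g gE] := proj _ _ p f; last by exists g.
apply/vspaceP => y; rewrite memvf; apply/memv_imgP.
by have [x <-] := pS y; exists x; rewrite ?memvf.
Qed.

Definition eval_at (V W : vectType K) (x : V) (f : 'Hom(V, W)) : W := f x.
Lemma eval_at_linear (V W : vectType K) x : linear (@eval_at V W x).
Proof. by move=> k f g; rewrite /eval_at add_lfunE scale_lfunE. Qed.
HB.instance Definition _ (V W : vectType K) x :=
  GRing.isLinear.Build K 'Hom(V, W) W _ (@eval_at V W x) (@eval_at_linear V W x).

Definition ract_at B (x : B) (a : A) : B := ract a x.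
HB.instance Definition _ B (x : B) :=
  GRing.isLinear.Build K A B _ (@ract_at B x) (@ract_linear_l K A B x).

Lemma precomp_bhom M M' N (j : mhom M M') :
  exists r : bhom (hom_bimodule M' N) (hom_bimodule M N), forall f x, r f x = f (j x).
Proof.
have [r rE] : exists r : bhom (hom_bimodule M' N) (hom_bimodule M N),
    r =1 (fun f => (f \o j)%VF).
  apply: bhom_exists => [k f g|a f|a f].
  - by rewrite comp_lfunDl comp_lfunZl.
  - by apply/lfunP => x; rewrite comp_lfunE !hom_lactE comp_lfunE.
  - by apply/lfunP => x; rewrite comp_lfunE !hom_ractE comp_lfunE mhomE.
by exists r => f x; rewrite rE comp_lfunE.
Qed.

Lemma postcomp_bhom M N N' (j : mhom N N') :
  exists r : bhom (hom_bimodule M N) (hom_bimodule M N'), forall f x, r f x = j (f x).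
Proof.
have [r rE] : exists r : bhom (hom_bimodule M N) (hom_bimodule M N'),
    r =1 (fun f => (j \o f)%VF).
  apply: bhom_exists => [k f g|a f|a f].
  - by rewrite comp_lfunDr comp_lfunZr.
  - by apply/lfunP => x; rewrite comp_lfunE !hom_lactE comp_lfunE mhomE.
  - by apply/lfunP => x; rewrite comp_lfunE !hom_ractE comp_lfunE.
by exists r => f x; rewrite rE comp_lfunE.
Qed.

(** Transpose f to a bimodule map from P to Hom_K(M, N). Restriction from Hom_K(M', N) is onto,
    since j has a linear retraction, so projectivity lifts the transpose; transposing back extends
    f. *)
Lemma hom_module_injective P N H (ev : mhom H (coind P N)) :
  bprojective P -> is_hom_module ev -> injective_module H.
Proof.
move=> proj [evI evE] M M' j f jI.
have evh h : exists u : mhom P N, forall x, u x = ev h x.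
  by have [u uE] := (evE (ev h)).1 (ex_intro _ h erefl); exists u => x; rewrite uE.
pose c x : 'Hom(M, N) := (linfun (eval_at x) \o (ev \o f))%VF.
have cE x m : c x m = ev (f m) x by rewrite !comp_lfunE lfunE.
have [phi phiE] : exists phi : bhom P (hom_bimodule M N), phi =1 c.
  apply: bhom_exists => [k x y|a x|a x]; apply/lfunP => m.
  - by rewrite add_lfunE scale_lfunE !cE linearP.
  - by rewrite hom_lactE !cE; have [u uE] := evh (f m); rewrite -!uE mhomE.
  - by rewrite hom_ractE !cE !mhomE coind_actE.
have [r rE] := precomp_bhom N j.
have [|psi psiE] := bprojective_lift (p := r) phi proj.
  move=> g; exists (g \o j^-1)%VF; apply/lfunP => x.
  by rewrite rE comp_lfunE lker0_lfunK //; apply/lker0P.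
pose d m' : 'Hom(P, N) := (linfun (eval_at m') \o psi)%VF.
have dE m' x : d m' x = psi x m' by rewrite !comp_lfunE lfunE.
have [k kE] : exists k : mhom M' (coind P N), k =1 d.
  apply: mhom_exists => [a x y|a x]; apply/lfunP => p.
    by rewrite add_lfunE scale_lfunE !dE linearP.
  by rewrite coind_actE !dE bhomE hom_ractE.
have [g gE] : exists g : mhom M' H, forall x, ev (g x) = k x.
  apply: factor_through_inj => // m'; apply/evE.
  have eqv a x : d m' (mact a x) = mact a (d m' x) by rewrite !dE mhomE hom_lactE.
  by exists (MHom eqv); rewrite kE.
exists g => m /=; apply: evI; rewrite gE kE; apply/lfunP => x.
by rewrite dE -rE psiE phiE cE.
Qed.

Definition left_projective M := forall M1 M2 (s : mhom M1 M2) (f : mhom M M2),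
  (forall y, exists x, s x = y) -> exists g : mhom M M1, forall x, s (g x) = f x.

(** Lift the bimodule map x |-> (b |-> f (x b)) along Hom_K(A, M1) -> Hom_K(A, M2), which is onto
    over a field, then evaluate at 1. *)
Lemma bprojective_left_projective P : bprojective P -> left_projective P.
Proof.
move=> proj M1 M2 s f sS; have [r rE] := postcomp_bhom (regular A) s.
pose c x : 'Hom(regular A, M2) := (f \o linfun (@ract_at P x))%VF.
have cE x b : c x b = f (ract b x) by rewrite comp_lfunE lfunE.
have [theta thetaE] : exists theta : bhom P (hom_bimodule (regular A) M2), theta =1 c.
  apply: bhom_exists => [k x y|a x|a x]; apply/lfunP => b.
  - by rewrite add_lfunE scale_lfunE !cE !linearP.
  - by rewrite hom_lactE !cE lract mhomE.
  - by rewrite hom_ractE !cE -ractM.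
have [|Theta ThetaE] := bprojective_lift (p := r) theta proj.
  move=> g; exists (s^-1 \o g)%VF; apply/lfunP => b.
  rewrite rE comp_lfunE limg_lfunVK //.
  by have [x <-] := sS (g b); rewrite memv_img ?memvf.
have [g gE] : exists g : mhom P M1, g =1 (fun x => Theta x 1).
  apply: mhom_exists => [k x y|a x].
    by rewrite linearP add_lfunE scale_lfunE.
  by rewrite mhomE hom_lactE.
by exists g => x; rewrite gE -rE ThetaE thetaE cE ract1.
Qed.

Lemma left_projective_regular : left_projective (regular A).
Proof.
move=> M1 M2 s f sS; have [e eE] := sS (f 1); have [h hE] := regular_hom e.
by exists h => a; rewrite hE mhomE eE -mhomE /= mulr1.
Qed.

Lemma left_projective_isom M N : isom M N -> left_projective M -> left_projective N.
Proof.
case/isom_inv=> i [j [ij ji]] lp M1 M2 s f sS.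
have [g gE] := lp _ _ s (mcomp f i) sS.
by exists (mcomp g j) => x; rewrite mcompE gE mcompE ji.
Qed.

Lemma left_projective_retraction L M N (i : mhom L M) (p : mhom M N) :
  short_exact i p -> left_projective N -> exists r : mhom M L, forall x, r (i x) = x.
Proof.
move=> ex lp; have /short_exactP[_ _ pS] := ex.
have [s sE] := lp _ _ p (mhom_id N) pS.
have [|r [rE _]] := @retraction_of_section _ _ _ _ _ i p s ex; last by exists r.
by move=> x; rewrite sE midE.
Qed.

Lemma left_projective_summand L M (i : mhom L M) (r : mhom M L) :
  (forall x, r (i x) = x) -> left_projective M -> left_projective L.
Proof.
move=> ri lp M1 M2 s f sS; have [g gE] := lp _ _ s (mcomp f r) sS.
by exists (mcomp g i) => x; rewrite mcompE gE mcompE ri.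
Qed.

Lemma hom_module_map B B' N H H' (ev : mhom H (coind B N)) (ev' : mhom H' (coind B' N))
    (b : bhom B B') : is_hom_module ev -> is_hom_module ev' ->
  exists h : mhom H' H, forall f x, ev (h f) x = ev' f (b x).
Proof.
move=> [evI evE] [_ evE'].
have [c cE] : exists c : mhom (coind B' N) (coind B N), c =1 (fun f => (f \o b)%VF).
  apply: mhom_exists => [k f g|a f]; first by rewrite comp_lfunDl comp_lfunZl.
  by apply/lfunP => x; rewrite comp_lfunE !coind_actE comp_lfunE bhomE.
have [h hE] : exists h : mhom H' H, forall f, ev (h f) = mcomp c ev' f.
  apply: factor_through_inj => // f; apply/evE.
  have [u uE] := (evE' (ev' f)).1 (ex_intro _ f erefl).
  by exists (mcomp u b); apply/lfunP => x; rewrite mcompE cE comp_lfunE uE mcompE.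
by exists h => f x; rewrite hE mcompE cE comp_lfunE.
Qed.

(** Only surjectivity at the right end needs the splitting: a left linear map u on L extends to u r
    on P. *)
Lemma hom_module_exact (L P C : bimodule A) N HL HP HC (evL : mhom HL (coind L N))
    (evP : mhom HP (coind P N)) (evC : mhom HC (coind C N))
    (i : bhom L P) (p : bhom P C) (r : mhom P L) :
  is_hom_module evL -> is_hom_module evP -> is_hom_module evC ->
  short_exact i p -> (forall x, r (i x) = x) ->
  exists (p' : mhom HC HP) (i' : mhom HP HL), short_exact p' i'.
Proof.
move=> hL hP hC ex ri; have /short_exactP[iI exi pS] := ex.
have [p' pE] := hom_module_map p hP hC; have [i' iE] := hom_module_map i hL hP.
have [[evLI evLE] [evPI evPE] [evCI evCE]] := And3 hL hP hC.
exists p', i'; apply/short_exactP; split.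
- apply: mhom_injP => h h0; apply: evCI; rewrite linear0; apply/lfunP => z.
  by have [y <-] := pS z; rewrite -pE h0 linear0 !zero_lfunE.
- move=> h; split=> [h0|[f <-]]; last first.
    apply: evLI; rewrite linear0; apply/lfunP => x.
    by rewrite iE pE (short_exact0 _ ex) linear0 zero_lfunE.
  have [u uE] := (evPE (evP h)).1 (ex_intro _ h erefl).
  have [k kE] : exists k : mhom C N, forall x, k (p x) = u x.
    apply: factor_through_surj => // y /exi[x <-].
    by rewrite -uE -iE h0 linear0 zero_lfunE.
  have [f fE] := (evCE k).2 (ex_intro _ k erefl).
  by exists f; apply: evPI; apply/lfunP => x; rewrite pE fE kE uE.
- move=> f; have [u uE] := (evLE (evL f)).1 (ex_intro _ f erefl).
  have [h hE] := (evPE (mcomp u r)).2 (ex_intro _ (mcomp u r) erefl).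
  exists h; apply: evLI; apply/lfunP => x.
  by rewrite iE hE mcompE ri uE.
Qed.

(** The isomorphism is evaluation at e. Since e generates B freely on the right and e a =
    sigma^-1(a) e, a left linear f is determined by f e, and (a f)(e) = sigma^-1(a) f(e). *)
Lemma hom_module_rank1 B N H (ev : mhom H (coind B N)) (e : B) (sigma : algaut A) :
  is_hom_module ev -> bijective (ract_at e) ->
  (forall a, mact a e = ract (sigma a) e) -> isom H (twist sigma N).
Proof.
move=> [evI evE] [t etK teK] eact.
have [h hE] : exists h : mhom H (twist sigma N), h =1 (fun f => ev f e).
  apply: mhom_exists => [k f g|a f]; first by rewrite linearP add_lfunE scale_lfunE.
  rewrite mhomE coind_actE /= /twist_act.
  have [u uE] := (evE (ev f)).1 (ex_intro _ f erefl).
  by rewrite uE -mhomE eact /= autVK.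
have evact f a : ev f (ract a e) = mact (aut_inv sigma a) (ev f e).
  have [u uE] := (evE (ev f)).1 (ex_intro _ f erefl).
  by rewrite uE -mhomE eact /= autVK.
have tlin : linear t.
  by move=> k x y; apply: (can_inj etK); rewrite teK linearP /= !teK.
exists h; apply/mhom_bijP; split=> [|n].
  apply: mhom_injP => f; rewrite hE => f0; apply: evI; rewrite linear0.
  apply/lfunP => x; rewrite zero_lfunE -[x]teK /ract_at evact.
  by rewrite f0 linear0.
have tact a x : t (mact a x) = sigma a * t x.
  apply: (can_inj etK); rewrite teK /ract_at ractM -eact lract.
  by rewrite -[in LHS](teK x).
have [u uE] : exists u : mhom B N, u =1 (fun x => mact (aut_inv sigma (t x)) (n : N)).
  apply: mhom_exists => [k x y|a x]; first by rewrite tlin linearP mactDl mactZl.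
  by rewrite -mactM tact rmorphM /= autK.
have [f fE] := (evE u).2 (ex_intro _ u erefl); exists f; rewrite hE fE uE.
have -> : t e = 1 by apply: (can_inj etK); rewrite teK /ract_at ract1.
by rewrite rmorph1 mact1.
Qed.

Lemma Ext1_zero_serre (mu eta : algaut A) M N :
  nakayama_automorphism eta ->
  is_iter_bsyzygy 3 (bregular A) (btwist mu (bregular A)) ->
  Ext1_zero M N -> Ext1_zero (twist (aut_inv (aut_comp (aut_inv eta) mu)) N) M.
Proof.
move=> /nakayama_frobenius[lam [rep frob]] syz ext.
case: syz => L2 [L1 [L0 iso0 [P0 [i0 [p0 [[proj0 _ _] ex0]]]]] [P1 [i1 [p1 [[proj1 _ _] ex1]]]]].
case=> P2 [i2 [p2 [[proj2 _ _] ex2]]].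
case: iso0 => b0 [c0 b0K c0K].
have lp0 : left_projective L0.
  apply: (@left_projective_isom (regular A)); last exact: left_projective_regular.
  by apply: isom_sym; exists (bhom_val b0); exists c0.
have [r0 r0E] := left_projective_retraction ex0 lp0.
have lp1 := left_projective_summand r0E (bprojective_left_projective proj0).
have [r1 r1E] := left_projective_retraction ex1 lp1.
have lp2 := left_projective_summand r1E (bprojective_left_projective proj1).
have [r2 r2E] := left_projective_retraction ex2 lp2.
(* The twist by [eta] cancels against the Nakayama functor, so that [isoH0] brings back N itself. *)
pose N' := twist eta N.
have [H0 [evH0 hH0]] := hom_module_exists L0 N'.
have [H1 [evH1 hH1]] := hom_module_exists L1 N'.
have [H2 [evH2 hH2]] := hom_module_exists L2 N'.
have [H3 [evH3 hH3]] := hom_module_exists (btwist mu (bregular A)) N'.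
have [J0 [evJ0 hJ0]] := hom_module_exists P0 N'.
have [J1 [evJ1 hJ1]] := hom_module_exists P1 N'.
have [J2 [evJ2 hJ2]] := hom_module_exists P2 N'.
have [a0 [q0 exact0]] := hom_module_exact hH1 hJ0 hH0 ex0 r0E.
have [a1 [q1 exact1]] := hom_module_exact hH2 hJ1 hH1 ex1 r1E.
have [a2 [q2 exact2]] := hom_module_exact hH3 hJ2 hH2 ex2 r2E.
have [k0 [pi0 [iota0 db0]]] := injective_dual_basis frob (hom_module_injective proj0 hJ0).
have [k1 [pi1 [iota1 db1]]] := injective_dual_basis frob (hom_module_injective proj1 hJ1).
have [k2 [pi2 [iota2 db2]]] := injective_dual_basis frob (hom_module_injective proj2 hJ2).
have isoH0 : isom (twist (aut_inv eta) H0) N.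
  apply: isom_trans (twist_invK eta N); apply: twist_isom.
  apply: isom_trans (twist_id N').
  have b0E a : b0 (ract a (c0 1)) = a by rewrite bhomE c0K /= mul1r.
  apply: (hom_module_rank1 (e := c0 1) hH0) => [|a].
    exists b0 => [a|x]; first exact: b0E.
    by apply: (can_inj b0K); rewrite b0E.
  by apply: (can_inj b0K); rewrite b0E mhomE c0K /= mulr1 id_lfunE.
(* In the twisted bimodule a 1 = 1 mu^-1(a), so evaluation at 1 twists N' by the inverse of [mu],
   and the inverse of eta^-1 o mu is mu^-1 o eta. *)
have isoH3 : isom H3 (twist (aut_inv (aut_comp (aut_inv eta) mu)) N).
  apply: (@isom_trans _ _ _ (twist (aut_inv mu) N')).
    apply: (hom_module_rank1 (B := btwist mu (bregular A)) (e := 1 : A) (sigma := aut_inv mu) hH3) => [|a].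
      by exists id => a; rewrite /ract_at /= mul1r.
    by rewrite /= /twist_act /= mulr1 mul1r.
  apply: (@isom_by_fun _ _ (twist (aut_inv mu) N')
    (twist (aut_inv (aut_comp (aut_inv eta) mu)) N) id id) => // a x.
  by rewrite /= /twist_act /= comp_lfunE.
apply: Ext1_zero_summandl (isom_summand (isom_sym isoH3)) _.
apply: (Ext1_zero_quotient exact2); first exact: dual_basis_Ext1_zero db2.
have /short_exactP[a1I ex1m q1S] := exact1.
have /short_exactP[a2I _ _] := exact2.
move=> h; pose d0 := mcomp a1 q0; pose d1 := mcomp a2 q1.
have d0E x : d0 x = a1 (q0 x) by exact: mcompE.
have d1E x : d1 x = a2 (q1 x) by exact: mcompE.
have dual := @exactness_duality eta lam rep J0 J1 J2 M k0 k1 k2 pi0 iota0 pi1 iota1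
  pi2 iota2 d0 d1 frob db0 db1 db2.
case: (dual _ (mcomp h q1)) => [v d1v|x|u uE].
(* A map killed by d1 takes values in nu H1; since nu H0 is N, the vanishing of Ext^1(M, N) lifts it
   to nu J0. *)
- have [v' v'E] : exists v' : mhom M (twist (aut_inv eta) H1),
      forall m, twist_hom (aut_inv eta) a1 (v' m) = v m.
    apply: factor_through_inj => // m; apply/ex1m/a2I.
    by rewrite -d1E d1v linear0.
  have extH0 : Ext1_zero M (twist (aut_inv eta) H0).
    exact: Ext1_zero_summandr (isom_summand isoH0) ext.
  have [v0 v0E] := Ext1_zero_lift v' extH0 (twist_short_exact (aut_inv eta) exact0).
  exists v0 => m; rewrite d0E -v'E -v0E; reflexivity.
- by rewrite mcompE d0E (short_exact0 _ exact1) linear0.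
- exists u => x; have [y <-] := q1S x.
  by rewrite -d1E uE mcompE.
Qed.

End SerreDuality.

(** * Approximations *)

Section Approximations.

Variables (K : fieldType) (A : falgType K).
Implicit Types (L M N S T X Y : lmodule A).

Definition extends_to M M' (f : mhom M M') N :=
  forall h : mhom M N, exists u : mhom M' N, forall x, u (f x) = h x.

Lemma extends_to_summand M M' (f : mhom M M') N N' :
  summand N N' -> extends_to f N' -> extends_to f N.
Proof.
case/summandP=> i [p pi] ext h; have [u uE] := ext (mcomp i h).
by exists (mcomp p u) => x; rewrite mcompE uE mcompE pi.
Qed.

Lemma extends_to_dsum2 M M' (f : mhom M M') N N' :
  extends_to f N -> extends_to f N' -> extends_to f (dsum2 N N').
Proof.
move=> ext ext' h; have [p pE] := dsum2_pr1_exists N N'.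
have [u uE] := ext (mcomp p h); have [v vE] := ext' (mcomp (dsum2_snd N N') h).
have [w wE] := pair_exists u v; exists w => x.
by rewrite wE uE vE !mcompE pE dsum2_sndE; case: (h x).
Qed.

Lemma extends_to_in_add M M' (f : mhom M M') T N :
  extends_to f T -> in_add T N -> extends_to f N.
Proof.
move=> ext [k sk]; apply: extends_to_summand sk _.
elim: k => [|k IH] /=; last exact: extends_to_dsum2.
move=> h; exists (mzero _ _) => x.
by rewrite mzeroE [RHS](proj1 (is_zeroP _) (@zero_moduleP K A)).
Qed.

Lemma left_approxP T M T' (f : mhom M T') :
  left_approx T f <-> in_add T T' /\ extends_to f T.
Proof.
split=> [[TT' app]|[TT' ext]]; split=> //.
  by move=> h; apply: app (in_add_self T).
by move=> N h /(extends_to_in_add ext); apply.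
Qed.

(** The components of f form a K-basis of Hom_A(M, T). Maps that factor through f form a subspace,
    so it suffices that the basis factors. *)
Lemma left_approx_exists M T : exists T' (f : mhom M T'), left_approx T f.
Proof.
have [U UE] := mhom_space_exists M T.
suff H (s : seq 'Hom(M, T)) : (forall h, h \in s -> exists u : mhom M T, h = u) ->
    exists k (F : mhom M (dsum k (fun=> T))),
      forall h, h \in s -> exists u : mhom (dsum k (fun=> T)) T, forall x, u (F x) = h x.
  have [|k [F FE]] := H (vbasis U); first by move=> h /vbasis_mem/UE.
  exists (dsum k (fun=> T)), F; apply/left_approxP; split.
    by apply: in_add_dsum => i _; apply: in_add_self.
  move=> h.
  have [||W WE] := @subspace_exists K 'Hom(M, T)
    (fun f => exists u : mhom (dsum k (fun=> T)) T, forall x, u (F x) = f x).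
  - by exists (mzero _ _) => x; rewrite mzeroE zero_lfunE.
  - move=> c f g [u uE] [v vE]; exists (madd (mscale c u) v) => x.
    by rewrite maddE mscaleE uE vE add_lfunE scale_lfunE.
  apply/WE; have hU : mhom_val h \in U by apply/UE; exists h.
  move: (mhom_val h) hU; apply/subvP; rewrite -(span_basis (vbasisP U)).
  by apply/span_subvP => f /FE/WE.
elim: s => [|h s IH] hs.
  by exists 0%N, (mzero _ _).
have [k [F FE]] := IH (fun h' h's => hs h' (mem_behead (s := h :: s) h's)).
have [h' hE] := hs h (mem_head _ _).
have [G GE] := pair_exists F h'.
exists k.+1, G => f; rewrite inE => /orP[/eqP ->|/FE[u uE]].
  by exists (dsum2_snd _ _) => x; rewrite dsum2_sndE GE hE.
have [p pE] := dsum2_pr1_exists (dsum k (fun=> T)) T.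
by exists (mcomp u p) => x; rewrite mcompE pE GE uE.
Qed.

Lemma fitting_nonbijective M (u : mhom M M) : ~ bijective u ->
  exists (e : mhom M M) k, [/\ forall x, e (e x) = e x, forall x, iter k u (e x) = 0,
    forall x, e (iter k u x) = 0 & ~ forall x, e x = 0].
Proof.
move=> uN; have [e [k [k0 ee ue eu ker]]] := fitting u.
exists e, k; split=> // e0; apply: uN; apply/mhom_endo_bij/mhom_injP => x ux.
rewrite -(e0 x); apply/esym/ker.
case: k k0 {ue eu ker} => // k _; rewrite iterSr ux.
by elim: k => //= k ->; rewrite linear0.
Qed.

Lemma iter_fix (Z : Type) (V : Type) (f : Z -> V) (u : V -> V) k :
  (forall x, u (f x) = f x) -> forall x, iter k u (f x) = f x.
Proof. by move=> uf x; elim: k => //= k ->. Qed.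

(** If u f = f with u singular, the Fitting projection e satisfies e f = e u^k f = 0. So f lands in
    the image of 1 - e, a strictly smaller summand that still approximates. *)
Lemma minimal_left_approx_exists M T :
  exists T' (f : mhom M T'), minimal_left_approx T f.
Proof.
have [T' [f app]] := left_approx_exists M T.
have [m] := ubnP (mdim T'); elim: m T' f app => // m IH T' f app; rewrite ltnS => dm.
case: (classic (left_minimal f)) => [min|nmin]; first by exists T', f.
have [u [uf uN]] : exists u : mhom T' T', u \o f =1 f /\ ~ bijective u.
  apply: NNPP => H; apply: nmin => u uf; apply: NNPP => uN; apply: H.
  by exists u.
have [e [k [ee ue eu e0]]] := fitting_nonbijective uN.
have ef x : e (f x) = 0 by rewrite -(iter_fix k uf x) eu.
have [S [i [p [pi ip]]]] : exists S (i : mhom S T') (p : mhom T' S),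
    (forall x, p (i x) = x) /\ (forall x, i (p x) = x - e x).
  have [|S [i [p [pi ip]]]] := @idempotent_split _ _ _ (msub (mhom_id T') e).
    by move=> x; rewrite !msubE !midE linearB /= ee subrr subr0.
  by exists S, i, p; split=> // x; rewrite ip msubE midE.
have iI : injective i by apply: can_inj pi.
have iPf x : i (p (f x)) = f x by rewrite ip ef subr0.
have sS : summand S T' by apply: summand_intro pi.
have /left_approxP[TT' ext] := app.
apply: (IH S (mcomp p f)).
  apply/left_approxP; split; first exact: in_add_summand TT'.
  move=> h; have [v vE] := ext h; exists (mcomp v i) => x.
  by rewrite !mcompE iPf vE.
rewrite (leq_trans _ dm) // ltn_neqAle (mdim_inj iI) andbT.
apply/negP => /eqP /(mdim_inj_bij iI) /mhom_bijP[_ iS]; apply: e0 => x.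
have [y <-] := iS x; have := ip (i y); rewrite pi => /eqP.
by rewrite eq_sym subr_eq addrC -subr_eq subrr eq_sym => /eqP.
Qed.

Definition no_summand_in_add T M :=
  forall S, indecomposable S -> summand S M -> ~ in_add T S.

Lemma no_summand_in_add_zero T M S :
  no_summand_in_add T M -> summand S M -> in_add T S -> is_zero S.
Proof.
move=> no sM sT; apply: NNPP => /indecomposable_summand_exists[N [ind sN]].
apply: (no N ind); first exact: summand_trans sM.
exact: in_add_summand sT.
Qed.

Lemma indecomposable_no_summand T M :
  indecomposable M -> ~ in_add T M -> no_summand_in_add T M.
Proof.
move=> ind nT S [S0 _] sS TS; apply: nT; apply: in_add_summand TS.
exact/isom_summand/isom_sym/summand_indecomposable.
Qed.

Lemma no_summand_dsum T n (F : nat -> lmodule A) :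
  (forall i, (i < n)%N -> no_summand_in_add T (F i)) -> no_summand_in_add T (dsum n F).
Proof. by move=> no S ind /(dsum_prime ind)[i /no]; apply. Qed.

(** * Short exact sequences with middle term in add(T) *)

Section ShortExact.

Variables (T X T' Y : lmodule A) (f : mhom X T') (g : mhom T' Y).
Hypothesis ex : short_exact f g.
Hypothesis addT' : in_add T T'.

(** A singular u with u f = f has a nonzero Fitting summand S of T' whose projection kills the image
    of f. The projection factors through g, so S is also a summand of Y. *)
Lemma left_minimal_of_no_summand : no_summand_in_add T Y -> left_minimal f.
Proof.
have /short_exactP[fI exm gS] := ex.
move=> no u uf; apply: NNPP => /fitting_nonbijective[e [k [ee ue eu e0]]].
have [S [i [p [pi ip]]]] := idempotent_split ee.
apply: e0 => x; rewrite -ip.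
suff /is_zeroP S0 : is_zero S by rewrite (S0 (p x)) linear0.
apply: (no_summand_in_add_zero no); last exact: in_add_summand (summand_intro pi) addT'.
have [q qE] : exists q : mhom Y S, forall y, q (g y) = p y.
  apply: factor_through_surj => // y /exm[z <-].
  by rewrite -(pi (p _)) ip -(iter_fix k uf z) eu linear0.
by apply: (@summand_intro _ _ _ _ (mcomp g i) q) => y; rewrite mcompE qE pi.
Qed.

(** Dually, g = g u^k vanishes on the Fitting summand S, whose inclusion then factors through f and
    makes S a summand of X. *)
Lemma right_minimal_of_no_summand : no_summand_in_add T X -> right_minimal g.
Proof.
have /short_exactP[fI exm gS] := ex.
move=> no u gu; apply: NNPP => /fitting_nonbijective[e [k [ee ue eu e0]]].
have [S [i [p [pi ip]]]] := idempotent_split ee.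
apply: e0 => x; rewrite -ip.
suff /is_zeroP S0 : is_zero S by rewrite (S0 (p x)) linear0.
apply: (no_summand_in_add_zero no); last exact: in_add_summand (summand_intro pi) addT'.
have gE y : g y = g (iter k u y) by elim: k {ue eu} => //= k ->; rewrite [RHS]gu.
have [j jE] : exists j : mhom S X, forall y, f (j y) = i y.
  apply: factor_through_inj => // y; apply/exm.
  by rewrite -(pi y) ip gE ue linear0.
by apply: (@summand_intro _ _ _ _ j (mcomp p f)) => y; rewrite mcompE jE pi.
Qed.

(** A summand S of Y in add(T) lifts to l : S -> T'. The map 1 - l p g fixes f, so it is bijective
    by minimality, yet it kills the image of l; hence S = 0. *)
Lemma no_summand_of_left_minimal :
  Ext1_zero T X -> left_minimal f -> no_summand_in_add T Y.
Proof.
move=> ext min S [S0 _] /summandP[s [p ps]] TS.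
have [l lE] := Ext1_zero_lift s (Ext1_zero_in_addl TS ext) ex.
have b : bijective (msub (mhom_id T') (mcomp l (mcomp p g))).
  by apply: min => x; rewrite /= msubE !mcompE midE (short_exact0 _ ex) !linear0 addr0.
apply: S0; apply/is_zeroP => y; apply/eqP; rewrite -(ps y) -lE.
have [bI _] := (mhom_bijP _).1 b.
suff -> : l y = 0 by rewrite !linear0.
by apply: bI; rewrite !msubE !mcompE !midE lE ps !linear0 addr0; apply: subrr.
Qed.

Lemma extends_Ext1_zero : Ext1_zero T T -> extends_to f T -> Ext1_zero Y T.
Proof.
move=> extTT ext; apply: (Ext1_zero_quotient ex) => //.
exact: Ext1_zero_in_addl extTT.
Qed.

Lemma right_approx_of_Ext1_zero : Ext1_zero T X -> right_approx T g.
Proof.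
move=> ext; split=> // N h TN.
by have [l lE] := Ext1_zero_lift h (Ext1_zero_in_addl TN ext) ex; exists l.
Qed.

(** High powers of the lift u vanish on X and descend to a map Y -> T' whose composite with g is e.
    Thus the image of e is a summand of T'. *)
Lemma nilpotent_lift_summand_zero (e : mhom Y Y) (u : mhom T' T') (x : mhom X X) k S
    (i : mhom S Y) (p : mhom Y S) : no_summand_in_add T Y ->
  (forall y, g (u y) = e (g y)) -> (forall z, f (x z) = u (f z)) ->
  (forall z, iter k x z = 0) -> (forall y, e (e y) = e y) ->
  (forall y, p (i y) = y) -> (forall y, i (p y) = e y) -> is_zero S.
Proof.
have /short_exactP[fI exm gS] := ex.
move=> no gu fx xk ee pi ip.
(* The exponent must be positive, since a zeroth power would lie over the identity instead of e. *)
have [w wE] := iter_mhom u k.+1.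
have wf z : w (f z) = 0.
  have fiter j : iter j u (f z) = f (iter j x z) by elim: j => //= j ->; rewrite fx.
  by rewrite wE fiter iterS xk !linear0.
have gw y : g (w y) = e (g y).
  rewrite wE; elim: k {xk w wE wf} => [|k IH]; first exact: gu.
  by rewrite iterS gu IH ee.
have [q qE] : exists q : mhom Y T', forall y, q (g y) = w y.
  by apply: factor_through_surj => // y /exm[z <-]; exact: wf.
have gq y : g (q y) = e y by have [t <-] := gS y; rewrite qE gw.
have ei y : e (i y) = i y by rewrite -ip pi.
apply: (no_summand_in_add_zero no); first exact: summand_intro pi.
apply: in_add_summand addT'.
by apply: (@summand_intro _ _ _ _ (mcomp q i) (mcomp p g)) => y; rewrite !mcompE gq ei pi.
Qed.

(** Complementary idempotents of Y lift to u and 1 - u on T' and restrict to x and 1 - x on X.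
    Locality makes one of the latter nilpotent, which kills the corresponding summand of Y. *)
Lemma cokernel_indecomposable : indecomposable X -> ~ in_add T X ->
  no_summand_in_add T Y -> Ext1_zero T X -> ~ is_zero Y -> indecomposable Y.
Proof.
have /short_exactP[fI exm gS] := ex.
move=> indX TX no ext Y0; split=> // N N' /isom_inv[s [t [sK tK]]].
have [p1 p1E] := dsum2_pr1_exists N N'; have [i2 i2E] := dsum2_in2_exists N N'.
pose i := mcomp t (dsum2_inl N N'); pose p := mcomp p1 s.
pose i' := mcomp t i2; pose p' := mcomp (dsum2_snd N N') s.
have pi y : p (i y) = y by rewrite /p /i !mcompE tK dsum2_inlE p1E.
have pi' y : p' (i' y) = y by rewrite /p' /i' !mcompE tK i2E dsum2_sndE.
have sum1 y : i (p y) + i' (p' y) = y.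
  rewrite /p /i /p' /i' !mcompE -(linearD t) dsum2_inlE p1E i2E dsum2_sndE.
  rewrite -[RHS]sK; congr (t _); case: (s y) => a b.
  by congr pair; rewrite /= ?addr0 ?add0r.
pose e := mcomp i p; pose e' := mcomp i' p'.
have eE y : e y = i (p y) by exact: mcompE.
have e'E y : e' y = i' (p' y) by exact: mcompE.
have ee y : e (e y) = e y by rewrite !eE pi.
have ee' y : e' (e' y) = e' y by rewrite !e'E pi'.
have sume y : e' y = y - e y by rewrite -[X in _ = X - _](sum1 y) eE e'E addrAC subrr add0r.
have extT' := Ext1_zero_in_addl addT' ext.
have [u uE] := Ext1_zero_lift (mcomp e g) extT' ex.
have [x xE] : exists x : mhom X X, forall z, f (x z) = mcomp u f z.
  apply: factor_through_inj => // z; apply/exm.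
  by rewrite mcompE uE mcompE (short_exact0 _ ex) linear0.
have gu y : g (u y) = e (g y) by rewrite uE mcompE.
have fx z : f (x z) = u (f z) by rewrite xE mcompE.
pose u' := msub (mhom_id T') u; pose x' := msub (mhom_id X) x.
have gu' y : g (u' y) = e' (g y) by rewrite msubE midE linearB /= gu sume.
have fx' z : f (x' z) = u' (f z) by rewrite !msubE !midE linearB /= fx.
(* Since e (1 - e) = 0, the endomorphism x (1 - x) factors through T'. *)
have [w wE] : exists w : mhom T' X, forall y, f (w y) = mcomp u u' y.
  apply: factor_through_inj => // y; apply/exm.
  by rewrite mcompE gu gu' sume linearB /= ee subrr.
have wf z : w (f z) = x (x' z) by apply: fI; rewrite wE mcompE fx fx'.
have xx'N : ~ bijective (mcomp w f).
  move=> /mhom_bij_inv[v [vK _]]; apply: TX; apply: in_add_summand addT'.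
  by apply: (@summand_intro _ _ _ _ f (mcomp v w)) => z; rewrite mcompE -[RHS]vK mcompE.
have [xN|x'N] : ~ bijective x \/ ~ bijective x'.
- apply: NNPP => /not_or_and[/NNPP b /NNPP b']; apply: xx'N.
  apply: (@eq_bij _ _ (x \o x')); first exact: bij_comp.
  by move=> z; rewrite mcompE wf.
- left; have [//|[k xk]] := indecomposable_endo x indX.
  exact: (nilpotent_lift_summand_zero no gu fx xk ee pi (fun y => esym (eE y))).
- right; have [//|[k xk]] := indecomposable_endo x' indX.
  exact: (nilpotent_lift_summand_zero no gu' fx' xk ee' pi' (fun y => esym (e'E y))).
Qed.

End ShortExact.

Lemma bij_id_plus_nonbij M (u : mhom M M) (v : mhom M M) : indecomposable M ->
  ~ bijective u -> (forall x, v x - x = u x) -> bijective v.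
Proof.
move=> ind uN vE; apply: (@eq_bij _ _ (madd (mhom_id M) u)).
  by apply: bij_add_nonbij => //; exists id => x; rewrite midE.
by move=> x; rewrite maddE midE -vE addrC subrK.
Qed.

(** An invertible composite would split M off T'. For M indecomposable this puts maps through add(T)
    in the radical of End(M). *)
Lemma in_add_nonbij T M T' (a : mhom M T') (b : mhom T' M) :
  in_add T T' -> ~ in_add T M -> ~ bijective (mcomp b a).
Proof.
move=> TT' TM /mhom_bij_inv[v [vK _]]; apply: TM; apply: in_add_summand TT'.
by apply: (@summand_intro _ _ _ _ a (mcomp v b)) => z; rewrite mcompE -[RHS]vK mcompE.
Qed.

Lemma isom_of_bij_comp M N (x : mhom M N) (y : mhom N M) :
  bijective (mcomp y x) -> bijective (mcomp x y) -> isom M N.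
Proof.
move=> /mhom_bijP[I _] /mhom_bijP[_ S]; exists x; apply/mhom_bijP; split.
  by move=> a b ab; apply: I; rewrite !mcompE ab.
by move=> b; have [a <-] := S b; exists (y a); rewrite mcompE.
Qed.

(** * Comparison of two exchange sequences *)

Section Uniqueness.

Variables (T X X' T1 T1' Y Y' : lmodule A).
Variables (f : mhom X T1) (g : mhom T1 Y) (f' : mhom X' T1') (g' : mhom T1' Y').
Hypothesis (ex : short_exact f g) (ex' : short_exact f' g').
Hypothesis (addT1 : in_add T T1) (addT1' : in_add T T1').

(** An isomorphism of the right ends and its inverse lift to the middle terms and restrict to x and
    y on the left. Here y x - 1 factors through T1, so it is singular and y x is invertible;
    likewise x y. *)
Lemma kernel_isom : indecomposable X -> indecomposable X' ->
  ~ in_add T X -> ~ in_add T X' -> Ext1_zero T X -> Ext1_zero T X' ->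
  isom Y Y' -> isom X X'.
Proof.
have /short_exactP[fI exm gS] := ex; have /short_exactP[fI' exm' gS'] := ex'.
move=> ind ind' TX TX' ext ext' /isom_inv[phi [psi [phiK psiK]]].
have [u uE] := Ext1_zero_lift (mcomp phi g) (Ext1_zero_in_addl addT1 ext') ex'.
have [v vE] := Ext1_zero_lift (mcomp psi g') (Ext1_zero_in_addl addT1' ext) ex.
have [x xE] : exists x : mhom X X', forall z, f' (x z) = mcomp u f z.
  apply: factor_through_inj => // z; apply/exm'.
  by rewrite mcompE uE mcompE (short_exact0 _ ex) linear0.
have [y yE] : exists y : mhom X' X, forall z, f (y z) = mcomp v f' z.
  apply: factor_through_inj => // z; apply/exm.
  by rewrite mcompE vE mcompE (short_exact0 _ ex') linear0.
have [w wE] : exists w : mhom T1 X, forall z, f (w z) = msub (mcomp v u) (mhom_id T1) z.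
  apply: factor_through_inj => // z; apply/exm.
  by rewrite msubE mcompE midE linearB /= vE mcompE uE mcompE phiK subrr.
have [w' wE'] : exists w : mhom T1' X', forall z,
    f' (w z) = msub (mcomp u v) (mhom_id T1') z.
  apply: factor_through_inj => // z; apply/exm'.
  by rewrite msubE mcompE midE linearB /= uE mcompE vE mcompE psiK subrr.
apply: (@isom_of_bij_comp _ _ x y).
  apply: (bij_id_plus_nonbij ind (in_add_nonbij (a := f) (b := w) addT1 TX)) => z.
  by rewrite !mcompE; apply: fI; rewrite linearB /= yE mcompE xE mcompE wE msubE mcompE midE.
apply: (bij_id_plus_nonbij ind' (in_add_nonbij (a := f') (b := w') addT1' TX')) => z.
by rewrite !mcompE; apply: fI'; rewrite linearB /= xE mcompE yE mcompE wE' msubE mcompE midE.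
Qed.

(** The dual argument: extension along the approximations replaces lifting, and the error terms
    again factor through the middle. *)
Lemma cokernel_isom : indecomposable Y -> indecomposable Y' ->
  ~ in_add T Y -> ~ in_add T Y' -> extends_to f T -> extends_to f' T ->
  isom X X' -> isom Y Y'.
Proof.
have /short_exactP[fI exm gS] := ex; have /short_exactP[fI' exm' gS'] := ex'.
move=> ind ind' TY TY' ext ext' /isom_inv[phi [psi [phiK psiK]]].
have [u uE] := extends_to_in_add ext addT1' (mcomp f' phi).
have [v vE] := extends_to_in_add ext' addT1 (mcomp f psi).
have [x xE] : exists x : mhom Y Y', forall z, x (g z) = mcomp g' u z.
  apply: factor_through_surj => // z /exm[t <-].
  by rewrite mcompE uE mcompE (short_exact0 _ ex').
have [y yE] : exists y : mhom Y' Y, forall z, y (g' z) = mcomp g v z.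
  apply: factor_through_surj => // z /exm'[t <-].
  by rewrite mcompE vE mcompE (short_exact0 _ ex).
have [w wE] : exists w : mhom Y T1, forall z, w (g z) = msub (mcomp v u) (mhom_id T1) z.
  apply: factor_through_surj => // z /exm[t <-].
  by rewrite msubE mcompE midE uE mcompE vE mcompE phiK subrr.
have [w' wE'] : exists w : mhom Y' T1', forall z,
    w (g' z) = msub (mcomp u v) (mhom_id T1') z.
  apply: factor_through_surj => // z /exm'[t <-].
  by rewrite msubE mcompE midE vE mcompE uE mcompE psiK subrr.
apply: (@isom_of_bij_comp _ _ x y).
  apply: (bij_id_plus_nonbij ind (in_add_nonbij (a := w) (b := g) addT1 TY)) => z.
  have [t <-] := gS z.
  by rewrite !mcompE xE mcompE yE mcompE wE msubE mcompE midE linearB.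
apply: (bij_id_plus_nonbij ind' (in_add_nonbij (a := w') (b := g') addT1' TY')) => z.
have [t <-] := gS' z.
by rewrite !mcompE yE mcompE xE mcompE wE' msubE mcompE midE linearB.
Qed.

End Uniqueness.

Lemma short_exact_dsum_hom n (F G H : nat -> lmodule A)
    (f : forall i, mhom (F i) (G i)) (g : forall i, mhom (G i) (H i)) :
  (forall i, short_exact (f i) (g i)) -> short_exact (dsum_hom n f) (dsum_hom n g).
Proof.
move=> ex; elim: n => [|n IH] /=.
  apply/short_exactP; split=> [x y|y|z]; first by rewrite !midE.
    have z0 (z : zero_module A) : z = 0 by apply: (proj1 (is_zeroP _) (@zero_moduleP K A)).
    by rewrite midE; split=> _; [exists y; rewrite midE | exact: z0].
  by exists z; rewrite midE.
have /short_exactP[fI exm gS] := ex n; have /short_exactP[I0 ex0 S0] := IH.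
apply/short_exactP; split.
- by case=> a b [a' b']; rewrite !dsum2_homE /= => -[/I0 -> /fI ->].
- case=> a b; rewrite dsum2_homE; split=> [[/ex0[x <-] /exm[y <-]]|[[x y]]].
    by exists (x, y); rewrite dsum2_homE.
  rewrite dsum2_homE /= => -[<- <-].
  by rewrite (short_exact0 _ IH) (short_exact0 _ (ex n)).
- case=> a b; have [x <-] := S0 a; have [y <-] := gS b.
  by exists (x, y); rewrite dsum2_homE.
Qed.

Lemma extends_to_dsum_hom n (F G : nat -> lmodule A) (f : forall i, mhom (F i) (G i)) T :
  (forall i, (i < n)%N -> extends_to (f i) T) -> extends_to (dsum_hom n f) T.
Proof.
elim: n => [|n IH] ext /= h.
  by exists h => x; rewrite midE.
have [i iE] := dsum2_in2_exists (dsum n F) (F n).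
have [u uE] := IH (fun i ltin => ext i (ltnW ltin)) (mcomp h (dsum2_inl _ _)).
have [v vE] := ext n (ltnSn n) (mcomp h i).
have [w wE] := copair_exists u v; exists w => -[x y].
rewrite dsum2_homE wE /= uE vE !mcompE -(linearD h) dsum2_inlE iE; congr (h _).
by congr pair; rewrite /= ?addr0 ?add0r.
Qed.

End Approximations.

(** * The exchange sequence *)

Section Orbits.

Variables (K : fieldType) (A : falgType K).
Implicit Types (L M N S T X Y : lmodule A) (phi gamma : algaut A).

Lemma dsum_shift n (F : nat -> lmodule A) :
  isom (dsum n.+1 F) (dsum2 (F 0%N) (dsum n (fun i => F i.+1))).
Proof.
elim: n => [|n IH] /=; first exact: dsum2C.
exact: isom_trans (isom_dsum2 IH (isom_refl _)) (isom_sym (dsum2A _ _ _)).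
Qed.

(** Twisting shifts the exponents by one, and periodicity brings the term of exponent n + 1 back to
    exponent 0. *)
Lemma orbit_sum_equivariant gamma n M :
  isom (twist (aut_pow gamma n.+1) M) M ->
  equivariant gamma (orbit_sum gamma n M).
Proof.
move=> iso; apply: isom_trans (twist_dsum _ _ _) _.
pose F i := twist (aut_pow gamma i) M.
apply: (@isom_trans _ _ _ (dsum n.+1 (fun i => F i.+1))).
  by apply: isom_dsum => i _; apply/isom_sym/twist_comp.
apply: isom_trans (isom_sym (dsum_shift n F)).
apply: isom_trans (dsum2C _ _); apply: isom_dsum2 (isom_refl _) _.
exact: isom_trans iso (isom_sym (twist_id M)).
Qed.

Lemma isom_cancel_dsum n (F : nat -> lmodule A) M N :
  (forall i, (i < n)%N -> indecomposable (F i)) ->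
  isom (dsum2 M (dsum n F)) (dsum2 N (dsum n F)) -> isom M N.
Proof.
elim: n => [|n IH] ind /= iso.
  apply: isom_trans (isom_dsum2_zero N (@zero_moduleP K A)).
  exact: isom_trans (isom_sym (isom_dsum2_zero M (@zero_moduleP K A))) iso.
apply: IH => [i /ltnW|]; first exact: ind.
have rot P : isom (dsum2 P (dsum2 (dsum n F) (F n))) (dsum2 (F n) (dsum2 P (dsum n F))).
  exact: isom_trans (dsum2A _ _ _) (dsum2C _ _).
apply: (isom_cancel (ind n (ltnSn n))).
exact: isom_trans (isom_sym (rot M)) (isom_trans iso (rot N)).
Qed.

Lemma aut_pow_equivariant gamma T i :
  equivariant gamma T -> isom (twist (aut_pow gamma i) T) T.
Proof.
move=> eqT; elim: i => [|i IH]; first exact: twist_id.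
apply: isom_trans (twist_comp _ _ _) _.
exact: isom_trans (twist_isom _ IH) eqT.
Qed.

Lemma in_add_base T T' M : isom T T' -> in_add T M -> in_add T' M.
Proof.
move=> iso; apply: in_add_trans.
by apply: in_add_summand (in_add_self T'); apply: isom_summand.
Qed.

Lemma in_add_isom T M N : isom M N -> in_add T M -> in_add T N.
Proof. by move=> /isom_sym/isom_summand; apply: in_add_summand. Qed.

Lemma equivariant_inv phi T : isom (twist phi T) T -> isom (twist (aut_inv phi) T) T.
Proof.
move=> iso; apply: isom_trans (twist_invK phi T).
exact/twist_isom/isom_sym.
Qed.

Lemma in_add_twist phi T M : isom (twist phi T) T -> in_add T M -> in_add T (twist phi M).
Proof. by move=> iso /(twist_in_add phi); apply: in_add_base. Qed.

Lemma in_add_untwist phi T M : isom (twist phi T) T -> in_add T (twist phi M) -> in_add T M.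
Proof.
move=> /equivariant_inv iso /(in_add_twist iso); apply: in_add_isom.
exact: twist_invK.
Qed.

Lemma extends_to_twist phi T M M' (f : mhom M M') : isom (twist phi T) T ->
  extends_to f T -> extends_to (twist_hom phi f) T.
Proof.
move=> iso ext; apply: (extends_to_summand (isom_summand (isom_sym iso))) => h.
have [h' hE] := untwist_hom h; have [u uE] := ext h'.
by exists (twist_hom phi u) => x; rewrite -hE; apply: uE.
Qed.

Lemma num_summands_dsum n (F : nat -> lmodule A) :
  (forall i, (i < n)%N -> indecomposable (F i)) ->
  (forall i j, (i < j < n)%N -> ~ isom (F i) (F j)) ->
  num_summands (dsum n F) n.
Proof.
move=> ind niso; exists F; split=> // [i ltin|N indN /(dsum_prime indN)[i ltin s]].
  by split; [apply: ind | apply: summand_dsum].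
by exists i => //; apply: summand_indecomposable (ind i ltin) _ s; case: indN.
Qed.

Lemma basic_dsum2 T Y : basic T -> basic Y -> no_summand_in_add T Y -> basic (dsum2 T Y).
Proof.
move=> /basicP bT /basicP bY no; apply/basicP => N ind.
case/(square_summand ind) => [/(bT N ind)//|/(bY N ind)//|[NT NY]].
apply: (no N ind NY); exact: in_add_summand NT (in_add_self T).
Qed.

Lemma basic_dsum2l T X : basic (dsum2 T X) -> basic T.
Proof.
move=> /basicP b; apply/basicP => N ind s; apply: (b N ind).
exact: summand_trans s (summand_dsum2l _ _).
Qed.

Lemma basic_dsum2_not_in_add T X N : basic (dsum2 T X) ->
  indecomposable N -> summand N X -> ~ in_add T N.
Proof.
move=> /basicP b ind NX /(indecomposable_in_add ind) NT; apply: (b N ind).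
exact: summand_dsum2.
Qed.

(** Maps from M to A separate points, and all of them factor through f. *)
Lemma left_approx_injective (eta : algaut A) lam rep T M T' (f : mhom M T') :
  frobenius_form eta lam rep -> in_add T (regular A) -> left_approx T f -> injective f.
Proof.
move=> frob TA [_ app]; apply: mhom_injP => x fx.
have [k [F F0]] := coordinates_exist M; apply: F0 => i.
have [p pE] := regular_hom_detects (F i) frob; apply: pE.
by have [u uE] := app _ p TA; rewrite -uE /= fx linear0.
Qed.

End Orbits.

Theorem proposition5p11 (K : closedFieldType) (A : falgType K)
    (mu eta : algaut A) (gamma := aut_comp (aut_inv eta) mu)
    (T X1 : lmodule A) (n : nat) (X := orbit_sum gamma n X1) :
  self_injective A ->
  is_iter_bsyzygy 3 (bregular A) (btwist mu (bregular A)) ->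
  nakayama_automorphism eta ->
  (forall M : lmodule A, basic M -> maximal_rigid M -> equivariant gamma M) ->
  basic (dsum2 T X) ->
  equivariant gamma (dsum2 T X) ->
  rigid (dsum2 T X) ->
  minimal_equivariant gamma n X1 X ->
  in_add T (regular A) ->
  exists (T1 Y1 : lmodule A) (f1 : mhom X1 T1) (g1 : mhom T1 Y1),
    let T' := orbit_sum gamma n T1 in
    let Y := orbit_sum gamma n Y1 in
    let f : mhom X T' := orbit_hom gamma n f1 in
    let g : mhom T' Y := orbit_hom gamma n g1 in
    (forall i, (i <= n)%N ->
       short_exact (twist_hom (aut_pow gamma i) f1)
                   (twist_hom (aut_pow gamma i) g1)) /\
    short_exact f g /\
    (minimal_left_approx T f /\ minimal_right_approx T g) /\
    (minimal_equivariant gamma n Y1 Y /\ ~ isom X Y) /\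
    (basic (dsum2 T Y) /\ equivariant gamma (dsum2 T Y) /\ rigid (dsum2 T Y)).
Proof.
move=> _ syz nak _ basicTX eqTX rigidTX [basicX _ indX1 _ periodX] addA.
have [lam [rep frob]] := nakayama_frobenius nak.
pose tw i (M : lmodule A) := twist (aut_pow gamma i) M.
have indX i : indecomposable (tw i X1) by apply: twist_indecomposable.
have summandX i : (i < n.+1)%N -> summand (tw i X1) X by apply: summand_dsum.
(* X is equivariant as an orbit sum, so it can be cancelled from the equivariance of T + X. *)
have eqT : equivariant gamma T.
  apply: (isom_cancel_dsum (n := n.+1) (F := fun i => tw i X1)) => //.
  apply: isom_trans eqTX; apply: isom_trans (isom_sym (twist_dsum2 _ _ _)).
  apply: isom_dsum2 (isom_refl _) _.
  exact/isom_sym/orbit_sum_equivariant.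
have eqTi i : isom (tw i T) T by apply: aut_pow_equivariant.
have tw0 M : isom (tw 0%N M) M by apply: twist_id.
have notX1 : ~ in_add T X1.
  move=> TX1; apply: (basic_dsum2_not_in_add basicTX (indX 0%N)).
    exact: summandX.
  exact: in_add_isom (isom_sym (tw0 X1)) TX1.
have notX i : ~ in_add T (tw i X1) by move/(in_add_untwist (eqTi i)).
have extTX_ M : Ext1_zero (dsum2 T X) M -> Ext1_zero T M /\ Ext1_zero X M.
  by move=> e; split; apply: Ext1_zero_summandl e; [apply: summand_dsum2l | apply: summand_dsum2r].
have [extTT extXT] : Ext1_zero T T /\ Ext1_zero X T.
  exact/extTX_/(Ext1_zero_summandr (summand_dsum2l T X)).
have [extTX extXX] : Ext1_zero T X /\ Ext1_zero X X.
  exact/extTX_/(Ext1_zero_summandr (summand_dsum2r T X)).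
have extTXi i : (i < n.+1)%N -> Ext1_zero T (tw i X1).
  by move=> ltin; apply: Ext1_zero_summandr (summandX i ltin) extTX.
have extTX1 : Ext1_zero T X1.
  exact: Ext1_zero_summandr (isom_summand (isom_sym (tw0 X1))) (extTXi 0%N isT).
have [T1 [f1 [app1 min1]]] := minimal_left_approx_exists X1 T.
have f1I := left_approx_injective frob addA app1.
have /left_approxP[addT1 ext1] := app1.
have [Y1 [g1 [g1S g1E]]] := cokernel_exists f1.
have ex1 : short_exact f1 g1 by apply/short_exactP.
have noY1 : no_summand_in_add T Y1 := no_summand_of_left_minimal ex1 extTX1 min1.
(* A zero cokernel would make [f1] an isomorphism and put X1 in add(T). *)
have Y1nz : ~ is_zero Y1.
  move=> /is_zeroP Y0; apply: notX1; apply: in_add_isom addT1; apply: isom_sym.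
  exists f1; apply/mhom_bijP; split=> // y; exact/g1E/Y0.
have indY1 : indecomposable Y1 := cokernel_indecomposable ex1 addT1 indX1 notX1 noY1 extTX1 Y1nz.
have indY i : indecomposable (tw i Y1) by apply: twist_indecomposable.
have notY1 : ~ in_add T Y1 by apply: noY1 (summand_refl _).
have notY i : ~ in_add T (tw i Y1) by move/(in_add_untwist (eqTi i)).
have addTi i : in_add T (tw i T1) by exact: in_add_twist (eqTi i) addT1.
have exi i : short_exact (twist_hom (aut_pow gamma i) f1) (twist_hom (aut_pow gamma i) g1).
  exact: twist_short_exact.
have exti i : extends_to (twist_hom (aut_pow gamma i) f1) T.
  exact: extends_to_twist (eqTi i) ext1.
exists T1, Y1, f1, g1 => T' Y f g.
have exfg : short_exact f g by apply: short_exact_dsum_hom.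
have addT' : in_add T T' by apply: in_add_dsum => i _; apply: addTi.
have extf : extends_to f T by apply: extends_to_dsum_hom => i _; apply: exti.
have noX : no_summand_in_add T X.
  by apply: no_summand_dsum => i _; exact: indecomposable_no_summand (indX i) (notX i).
have noY : no_summand_in_add T Y.
  by apply: no_summand_dsum => i _; exact: indecomposable_no_summand (indY i) (notY i).
have nisoY i j : (i < j < n.+1)%N -> ~ isom (tw i Y1) (tw j Y1).
  move=> ijn iso; have /andP[ij jn] := ijn.
  have isoX : isom (tw i X1) (tw j X1).
    exact: (kernel_isom (exi i) (exi j) (addTi i) (addTi j) (indX i) (indX j)
      (notX i) (notX j) (extTXi i (ltn_trans ij jn)) (extTXi j jn) iso).
  move/basicP: basicX => /(_ _ (indX i)); apply.
  apply: summand_trans (summand_dsum_pair _ ijn).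
  exact: summand_dsum2 (summand_refl _) (isom_summand isoX).
have basicY : basic Y by exists n.+1, (fun i => tw i Y1); split=> //; apply: isom_refl.
(* The sequence twisted by gamma^(n+1) and the original one have isomorphic left ends. *)
have periodY : isom (tw n.+1 Y1) Y1.
  exact: (cokernel_isom (exi n.+1) ex1 (addTi n.+1) addT1 (indY n.+1) indY1
    (notY n.+1) notY1 (exti n.+1) ext1 periodX).
have extYT : Ext1_zero Y T by apply: (extends_Ext1_zero exfg).
have extTY : Ext1_zero T Y.
  apply: Ext1_zero_summandl (Ext1_zero_serre nak syz extYT).
  exact/isom_summand/isom_sym/equivariant_inv.
have extYY : Ext1_zero Y Y.
  apply: (Ext1_zero_quotient exfg); first exact: Ext1_zero_in_addl extTY.
  (* Vanishing of Ext^1(X, X) lifts h along g to a map X -> T', and the approximation f extends this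
     lift to T'. *)
  move=> h; have [l lE] := Ext1_zero_lift h extXX exfg.
  have [k kE] := extends_to_in_add extf addT' l.
  by exists (mcomp g k) => x; rewrite mcompE kE lE.
split; first by move=> i _; apply: exi.
split; first exact: exfg.
split.
  split; first by split; [exact/left_approxP | exact: (left_minimal_of_no_summand exfg addT' noY)].
  split; first exact: (right_approx_of_Ext1_zero exfg addT' extTX).
  exact: (right_minimal_of_no_summand exfg addT' noX).
split.
  split; first by split=> //; [exact: (num_summands_dsum (fun i _ => indY i)) | exact: isom_refl].
  (* If X and Y were isomorphic, Ext^1(Y, X) would vanish, the sequence would split, and X would be
     a summand of T'. *)
  move=> /isom_sym/isom_summand YX.
  have [r rE] := (Ext1_zeroP _ _).1 (Ext1_zero_summandl YX extXX) _ _ _ exfg.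
  apply: (notX 0%N); apply: in_add_summand addT'.
  exact: summand_trans (summandX 0%N isT) (summand_intro rE).
split; first exact: basic_dsum2 (basic_dsum2l basicTX) basicY noY.
split.
  apply: isom_trans (twist_dsum2 _ _ _) _.
  by apply: isom_dsum2 eqT _; apply: orbit_sum_equivariant.
by apply: Ext1_zero_dsum2l; apply: Ext1_zero_dsum2r.
Qed.
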